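(* Let $C$ be a tropical curve of genus $g$. Consider the set of the $2^g$ theta characteristics $\mathcal K_0+t$, $t\in\frac12\Lambda/\Lambda\subset J(C)\cong\operatorname{Pic}^0(C)$, in $\operatorname{Pic}^{g-1}(C)$. Among these theta characteristics, $\mathcal K_0$ is the only one that does not lie in $W_{g-1}$.
   Context: **Tropical curves.** Let $\Gamma$ be a connected finite graph and $\mathcal V_1(\Gamma)$ its set of 1-valent vertices. $\Gamma$ is a metric graph if $\Gamma\setminus\mathcal V_1(\Gamma)$ is given a complete metric structure and $\Gamma$ is its compactification (so all leaves have infinite length). Introducing a new two-valent vertex in the interior of an edge gives an equivalent metric graph; a tropical curve $C$ is an equivalence class of such graphs. Its genus is $g=b_1(\Gamma)$. For $p\in C$, $\operatorname{val}(p)$ is the valence of $p$. **Divisors.** A divisor is a finite formal sum $D=\sum a_ip_i$ with $a_i\in\mathbb Z$, $p_i\in C$; $\deg D=\sum a_i$; $D$ is effective ($D\ge 0$) if all $a_i\ge0$. For a piecewise linear function $f$ on $C$ with integral slopes (finitely many linear pieces, infinite values being allowed at the ends of leaves), $(f)=\sum_{p\in C}\big(\sum_{i=1}^{\operatorname{val}(p)}\frac{\partial f(p)}{\partial\xi_i}\big)p$, where $\xi_i$ are the outward primitive (unit) tangent vectors at $p$; such divisors are called principal. $D_1\sim D_2$ (linear equivalence) means $D_1-D_2$ is principal. $\operatorname{Pic}^d(C)$ is the set of degree $d$ divisors modulo $\sim$. The canonical divisor is $K=\sum_{p\in C}(\operatorname{val}(p)-2)p$, of degree $2g-2$. $W_{g-1}\subset\operatorname{Pic}^{g-1}(C)$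 is the set of classes of effective divisors of degree $g-1$. **Jacobian.** Let $\operatorname{Aff}$ be the sheaf of local PL functions $f$ with integral slopes and $(f)=0$; the sheaf $\mathcal T^*_{\mathbb Z}$ is defined by the exact sequence $0\to\mathbb R\to\operatorname{Aff}\to\mathcal T^*_{\mathbb Z}\to0$. The rank $g$ lattice of 1-forms $\Omega_{\mathbb Z}(C)$ is the group of global sections of $\mathcal T_{\mathbb Z}^*$. $\Omega(C)^*$ is the vector space of $\mathbb R$-valued linear functionals on $\Omega_{\mathbb Z}(C)$; $\Lambda\subset\Omega(C)^*$ is the lattice given by $H_1(C,\mathbb Z)$ acting by integration. The Jacobian is $J(C)=\Omega(C)^*/\Lambda$. Fix $p_0\in C$. The Abel–Jacobi map $\mu^d$ sends a degree $d$ divisor $\sum a_ip_i$ to the class in $J(C)$ of $\omega\mapsto\sum a_i\int_{p_0}^{p_i}\omega$. By the tropical Abel–Jacobi theorem, $\mu^d$ factors through a bijection $\phi:\operatorname{Pic}^d(C)\to J(C)$ for each $d$; for $d=0$ it is independent of $p_0$ and is used to identify $\operatorname{Pic}^0(C)$ with $J(C)$. Write $\mu=\mu^1|_C:C\to J(C)$. **Theta function and $\mathcal K_0$.** Let $Q$ be the symmetric positive definite bilinear form on $\Omega(C)^*$ determined by the metric, $Q(\ell,\ell)=\operatorname{length}(\ell)$ on simple cycles $\ell$ (for cycles $\lambda=\sum a_ee$, $\lambda'=\sum b_ee$ over oriented edges, $Q(\lambda,\lambda')=\sum a_eb_e\operatorname{length}(e)$). Put $\Theta(x)=\max_{\lambda\in\Lambda}\{Q(\lambda,x)-\frac12Q(\lambda,\lambda)\}$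 for $x\in\Omega(C)^*$. Its corner locus descends to the theta divisor $[\Theta]\subset J(C)$. For $\lambda\in J(C)$ let $[\Theta_\lambda]=[\Theta]+\lambda$ and let $D_\lambda=\mu^*[\Theta_\lambda]$ be its pull-back to $C$, an effective divisor of degree $g$ (locally the divisor of $x\mapsto\Theta(\tilde\mu(x)-\tilde\lambda)$ for lifts $\tilde\mu,\tilde\lambda$ of $\mu,\lambda$ to $\Omega(C)^*$). By tropical Jacobi inversion there is a universal $\kappa$ such that $\mu^g(D_\lambda)+\kappa=\lambda$ for all $\lambda\in J(C)$. Let $\mathcal K_0=-\kappa$, that is, the class in $\operatorname{Pic}^{g-1}(C)$ with $\phi(\mathcal K_0)=-\kappa$; it satisfies $2\mathcal K_0=[K]$ in $\operatorname{Pic}^{2g-2}(C)$. **Theta characteristics.** A theta characteristic is a class $\mathcal K\in\operatorname{Pic}^{g-1}(C)$ with $2\mathcal K=[K]$ in $\operatorname{Pic}^{2g-2}(C)$ (equivalently $2\phi(\mathcal K)=\mu^{2g-2}(K)$). The set of theta characteristics is $\mathcal K_0+\frac12\Lambda/\Lambda$. *)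

(* Defs.v *)
From HB Require Import structures.
From mathcomp Require Import all_boot all_order all_algebra.
From mathcomp Require Import all_classical all_reals all_analysis.
From mathcomp Require Import freeg.

Set Implicit Arguments.
Unset Strict Implicit.
Unset Printing Implicit Defensive.

Import Order.TTheory GRing.Theory Num.Theory.
Import numFieldNormedType.Exports.

Local Open Scope classical_set_scope.
Local Open Scope ring_scope.

(* An oriented edge: (e, true) is e run from src to tgt, (e, false) is e run
   from tgt to src. *)
Fixpoint is_walk (V E : finType) (src tgt : E -> V) (v : V)
    (s : seq (E * bool)) (w : V) : bool :=
  if s is (e, b) :: s' then
    ((if b then src e else tgt e) == v) &&
      is_walk src tgt (if b then tgt e else src e) s' w
  else v == w.

(* A graph model of a tropical curve.  Loops, multiple edges and 2-valent
   vertices are allowed.  An edge has infinite length exactly when it is a leaf;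
   it is then oriented towards its 1-valent end, which is the point at infinity.
   Every tropical curve has such a model: the only metric graph with an edge
   joining two 1-valent vertices is [-oo, +oo], and one introduces a 2-valent
   vertex on it. *)
Record tropical_curve (R : realType) := TropicalCurve {
  vertex : finType;
  edge : finType;
  src : edge -> vertex;
  tgt : edge -> vertex;
  len : edge -> \bar R;
  valence := fun v => (#|[pred e | src e == v]| + #|[pred e | tgt e == v]|)%N;
  vertex_nonempty : (0 < #|vertex|)%N;
  curve_connected : forall v w, exists s, is_walk src tgt v s w;
  len_gt0 : forall e, (0 < len e)%E;
  leafE : forall e, (len e == +oo%E) = (valence (tgt e) == 1%N);
  src_not_leaf : forall e, valence (src e) != 1%N
}.

Section TropicalCurve.
Variables (R : realType) (C : tropical_curve R).

Notation V := (vertex C).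
Notation E := (edge C).

(* First Betti number: the rank of the kernel of the boundary map. *)
Definition boundary_mx : 'M[rat]_(#|E|, #|V|) :=
  \matrix_(i, j) ((tgt (enum_val i) == enum_val j)%:R -
                  (src (enum_val i) == enum_val j)%:R).

Definition genus : nat := \rank (kermx boundary_mx).

(* (e, x) is the point of the interior of e at distance x from src e. *)
Definition inner : Type :=
  {q : E * R | (0 < q.2) && (q.2%:E < len q.1)%E}.

Definition curve_point : Type := (V + inner)%type.

(* The chart of the edge e: the point at distance x from src e, for x real in
   [0, len e].  On a leaf it does not reach the point at infinity. *)
Definition chart (e : E) (x : R) : curve_point :=
  if x <= 0 then inl (src e)
  else if (insub (e, x) : option inner) is Some q then inr q else inl (tgt e).

(* The outward primitive tangent directions at a point, as oriented edges. *)
Definition tangents (p : curve_point) : seq (E * bool) :=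
  match p with
  | inl v => [seq (e, true) | e <- enum E & src e == v] ++
             [seq (e, false) | e <- enum E & tgt e == v]
  | inr q => [:: ((val q).1, true); ((val q).1, false)]
  end.

Definition sgn (b : bool) : R := if b then 1 else -1.

(* Right derivative at 0. *)
Definition rderiv0 (g : R -> R) : R :=
  lim ((g h - g 0) / h @[h --> 0^'+]).

Definition divisor : Type := {freeg curve_point / int}.

Definition effective (D : divisor) : Prop := forall p, 0 <= coeff p D.

(* Piecewise linear functions with integral slopes and finitely many pieces.
   The (possibly infinite) value at the end of a leaf is the limit along the
   leaf; the value f takes there is irrelevant, charts of leaves never reaching
   it.  Continuity at the finite vertices follows since the intervals [x, y] are
   closed. *)
Definition PL (f : curve_point -> R) : Prop :=
  forall e, exists breaks : seq R, forall x y : R,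
    0 <= x -> x <= y -> (y%:E <= len e)%E ->
    (forall b, b \in breaks -> ~~ (x < b < y)) ->
    exists n : int, forall z, x <= z <= y ->
      f (chart e z) = f (chart e x) + n%:~R * (z - x).

(* The derivative of f at p along the tangent direction d of p.  At the end of
   a leaf the outward direction points back into the leaf. *)
Definition slope (f : curve_point -> R) (p : curve_point) (d : E * bool) : R :=
  let: (e, b) := d in
  match p with
  | inl v =>
      if b then rderiv0 (fun h => f (chart e h))
      else if len e == +oo%E then
        - lim (derive1 (fun y : R => f (chart e y)) x @[x --> +oo])
      else rderiv0 (fun h => f (chart e (fine (len e) - h)))
  | inr q => rderiv0 (fun h => f (chart e ((val q).2 + sgn b * h)))
  end.

Definition is_div (f : curve_point -> R) (D : divisor) : Prop :=
  forall p, (coeff p D)%:~R = \sum_(d <- tangents p) slope f p d.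

Definition principal (D : divisor) : Prop :=
  exists2 f, PL f & is_div f D.

Definition lin_equiv (D D' : divisor) : Prop := principal (D - D').

(* A class in Pic is the set of its representatives. *)
Definition dclass (D : divisor) : set divisor := [set D' | lin_equiv D' D].

(* W d is the set of classes of effective divisors of degree d. *)
Definition W (d : int) : set (set divisor) :=
  dclass @` [set D : divisor | deg D = d /\ effective D].

(* Integer weights on the oriented edges with zero boundary.  They are the
   integral cycles, that is, the elements of H_1(C, Z).  They are also the
   integral 1-forms: a global section of Aff / R is a choice of an integral
   slope on each edge such that the outgoing slopes add up to 0 at each vertex.
   Both vanish on leaves. *)
Definition balanced : {pred {ffun E -> int}} := fun w =>
  [forall v : V, \sum_(e | src e == v) w e == \sum_(e | tgt e == v) w e].

Fact balanced_zmod_closed : zmod_closed balanced.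
Proof.
split=> [|w w' /forallP wb /forallP wb'].
  by apply/forallP => v; rewrite !big1 // => e _; rewrite ffunE.
apply/forallP => v.
under eq_bigr do rewrite !ffunE.
under [X in _ == X]eq_bigr do rewrite !ffunE.
by rewrite !sumrB (eqP (wb v)) (eqP (wb' v)).
Qed.
HB.instance Definition _ :=
  GRing.isZmodClosed.Build {ffun E -> int} balanced balanced_zmod_closed.

Record oneform := Form { form_val :> {ffun E -> int}; _ : balanced form_val }.
HB.instance Definition _ := [isSub for form_val].
HB.instance Definition _ := [Choice of oneform by <:].
HB.instance Definition _ := [SubChoice_isSubZmodule of oneform by <:].

(* Elements of Omega(C)^* are functions oneform -> R that are additive; those of
   the Jacobian are given by a lift to Omega(C)^*, up to the lattice below.
   Infinite lengths are only ever multiplied by 0, forms being 0 on leaves. *)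

(* Integral of a form along the oriented edge d. *)
Definition edge_integral (d : E * bool) (w : oneform) : R :=
  sgn d.2 * (w d.1)%:~R * fine (len d.1).

Definition integral_cycle (c w : oneform) : R :=
  \sum_e (c e)%:~R * (w e)%:~R * fine (len e).

Definition lattice : set (oneform -> R) := range integral_cycle.

Definition eq_mod_lattice (x y : oneform -> R) : Prop := lattice (x - y).

(* x is in 1/2 Lambda. *)
Definition half_lattice (x : oneform -> R) : Prop := lattice (x + x).

(* A path from p0 to p is, up to homotopy, a walk in the graph from the anchor
   of p0 to the anchor of p, completed by edge segments at both ends. *)
Definition anchor (p : curve_point) : V :=
  match p with inl v => v | inr q => src (val q).1 end.

Definition anchor_integral (p : curve_point) (w : oneform) : R :=
  match p with inl _ => 0 | inr q => (w (val q).1)%:~R * (val q).2 end.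

Definition path_integral (p0 p : curve_point) (s : seq (E * bool))
    : oneform -> R :=
  fun w => anchor_integral p w - anchor_integral p0 w +
           \sum_(d <- s) edge_integral d w.

Definition mu_lifts (p0 p : curve_point) : set (oneform -> R) :=
  [set path_integral p0 p s |
    s in [set s | is_walk (@src R C) (@tgt R C) (anchor p0) s (anchor p)]].

(* A choice of lift of mu(p) to Omega(C)^*, for each p. *)
Definition mu (p0 p : curve_point) : oneform -> R :=
  xget (fun=> 0) (mu_lifts p0 p).

(* A lift of mu^d(D), d = deg D. *)
Definition abel_jacobi (p0 : curve_point) (D : divisor) : oneform -> R :=
  fun w => \sum_(p <- dom D) (coeff p D)%:~R * mu p0 p w.

(* Q c x for c in Lambda and x in Omega(C)^*: the cycle c is identified with
   the form with the same coefficients, so that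
   Q c (integral_cycle c') = \sum_e c e * c' e * len e. *)
Definition Q (c : oneform) (x : oneform -> R) : R := x c.

(* The supremum is a maximum. *)
Definition Theta (x : oneform -> R) : R :=
  sup [set Q c x - 2^-1 * Q c (integral_cycle c) | c in setT].

(* The image of the unit tangent vector d under the differential of mu. *)
Definition dmu (d : E * bool) : oneform -> R := fun w => sgn d.2 * (w d.1)%:~R.

(* D = D_lambda, the divisor of the function which near p is
   Theta (mu~ - lambda~), where mu~ is the lift of mu that takes the value
   mu p0 p at p.  It does not depend on the lifts. *)
Definition is_theta_divisor (p0 : curve_point) (lambda : oneform -> R)
    (D : divisor) : Prop :=
  forall p, (coeff p D)%:~R =
    \sum_(d <- tangents p)
      rderiv0 (fun h => Theta (fun w => mu p0 p w + h * dmu d w - lambda w)).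

(* kappa is the constant of tropical Jacobi inversion. *)
Definition is_inversion_constant (p0 : curve_point) (kappa : oneform -> R)
    : Prop :=
  forall (lambda : {additive oneform -> R}) (D : divisor),
    is_theta_divisor p0 lambda D ->
    eq_mod_lattice (abel_jacobi p0 D + kappa) lambda.

(* The set [K0] + 1/2 Lambda / Lambda in Pic: its elements are the [K0] + t, where
   t in 1/2 Lambda / Lambda is identified with the class of the divisors T of
   degree 0 with mu^0(T) = t. *)
Definition half_period_translates (p0 : curve_point) (K0 : divisor)
    : set (set divisor) :=
  [set dclass (K0 + T) |
    T in [set T : divisor | deg T = 0 /\ half_lattice (abel_jacobi p0 T)]].

End TropicalCurve.

(* Main.v *)
Require Import Defs.
From HB Require Import structures.
From mathcomp Require Import all_boot all_order all_algebra.
From mathcomp Require Import all_classical all_reals all_analysis.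
From mathcomp Require Import freeg.
From mathcomp Require Import zify ring lra.

Set Implicit Arguments.
Unset Strict Implicit.
Unset Printing Implicit Defensive.

Import Order.TTheory GRing.Theory Num.Theory.
Import numFieldNormedType.Exports.

Local Open Scope classical_set_scope.
Local Open Scope ring_scope.

(** The proof replaces theta characteristics by divisors of orientations.  Put
    one marked point on each edge and orient the two pieces of the edge towards
    it.  The sum of the marked points minus the sum of the vertices is then the
    divisor of (indegree - 1), of degree [#|E| - #|V| = g - 1]
    ([marked_divisor]).  Apart from the edges of a cycle, the orientations used
    here point away from a set [S] of vertices: with [f] the distance to [S], the
    mark of an edge is the point that is farthest from [S].

    First take [S = {p}], with marked divisor [K].  For a chain [c] from [p] to
    [x], completing the square in the definition of Theta gives, at the image of
    [c], half of [|c|^2 - min |c'|^2] over the integral chains [c'] from [p] to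
    [x].  This minimum is the distance from [p] to [x]: it is at least that
    because [n^2 >= |n|] for integers [n] and [f] is 1-Lipschitz, and a shortest
    path attains it ([ThetaE]).  Since [|c|^2] is linear along each edge, the
    divisor of [x |-> Theta (mu x - mu p)] can be read off: it is [K + p]
    ([theta_divisor_distance]).  Jacobi inversion at [lambda = mu p] therefore
    says that [K] has the same Abel-Jacobi image as [K0], and [K0 ~ K] by the
    injectivity part of the Abel-Jacobi theorem ([abel]).

    No effective divisor is equivalent to [K].  Suppose that [K + (h)] is
    effective and take, among the vertices where [h] is maximal, one that is
    closest to [p].  Going from there towards [p] the function [h] decreases
    strictly, and it increases in no direction, so [(h)] is at most minus the
    indegree there and [K + (h)] is negative ([no_effective_function]).

    For a half period [t] not in the lattice, [2t] is congruent modulo [2 Lambda]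
    to a cycle [g <> 0] with coefficients 0, 1 and -1 ([mod2_representative]).
    Orient the support of [g] along [g] and everything else away from it.  Each
    vertex now has an incoming edge, so the divisor is effective
    ([cycle_divisor_effective]).  As a chain with coefficients 1 and -1 this
    orientation is [g] plus the gradient of a function, while that of [K] is a
    gradient.  Reversing a segment changes the divisor by the boundary of the
    segment, and gradients integrate to 0 against balanced forms, so the two
    divisors differ by [g / 2] in the Jacobian ([abel_jacobi_cycle_divisor]).
    Hence [K0 + t] is the class of an effective divisor.

    Forms vanish on the infinite leaves, so that a leaf can be given length 1
    wherever only integrals matter ([ell]). *)

(** * Integral chains on the graph *)

Section Chains.
Variables (R : realType) (C : tropical_curve R).
Notation V := (vertex C).
Notation E := (edge C).
Implicit Types (c : {ffun E -> int}) (w : oneform C) (d : E * bool).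
Implicit Types (e : E) (v : V) (s : seq (E * bool)).

Definition orig d : V := if d.2 then src d.1 else tgt d.1.
Definition dest d : V := if d.2 then tgt d.1 else src d.1.

(** The boundary of the chain [c]: inflow minus outflow.  Balanced functions are
    the chains without boundary. *)
Definition net c v : int :=
  \sum_(e | tgt e == v) c e - \sum_(e | src e == v) c e.

Definition edge_chain d : {ffun E -> int} :=
  [ffun e => if d.1 == e then if d.2 then 1 else -1 else 0].

Definition walk_chain s : {ffun E -> int} := \sum_(d <- s) edge_chain d.

Lemma balancedP c : reflect (forall v, net c v = 0) (balanced c).
Proof.
apply: (iffP forallP) => [bc v|bc v].
  by rewrite /net (eqP (bc v)) subrr.
by move/eqP: (bc v); rewrite subr_eq0 eq_sym.
Qed.

Lemma netD c c' v : net (c + c') v = net c v + net c' v.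
Proof.
rewrite /net.
under eq_bigr do rewrite ffunE.
under [in X in _ - X]eq_bigr do rewrite ffunE.
by rewrite !big_split /= opprD addrACA.
Qed.

Lemma netN c v : net (- c) v = - net c v.
Proof.
rewrite /net.
under eq_bigr do rewrite ffunE.
under [in X in _ - X]eq_bigr do rewrite ffunE.
by rewrite !sumrN opprD.
Qed.

Lemma net0 v : net 0 v = 0.
Proof. by rewrite /net !big1 ?subrr// => e _; rewrite ffunE. Qed.

Lemma net_sum (I : Type) (r : seq I) (F : I -> {ffun E -> int}) v :
  net (\sum_(i <- r) F i) v = \sum_(i <- r) net (F i) v.
Proof. by elim/big_rec2: _ => [|i y x _ <-]; rewrite ?net0 ?netD. Qed.

Lemma chain_mulz c (n : int) e : (c *~ n) e = c e * n.
Proof.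
rewrite -[RHS]mulrzz; case: n => n; first by rewrite -!pmulrn ffunMnE.
by rewrite NegzE !mulrNz ffunE -!pmulrn ffunMnE.
Qed.

Lemma netMz c (n : int) v : net (c *~ n) v = net c v * n.
Proof.
rewrite /net.
under eq_bigr do rewrite chain_mulz.
under [in X in _ - X]eq_bigr do rewrite chain_mulz.
by rewrite -!mulr_suml -mulrBl.
Qed.

Lemma net_edge_chain d v : net (edge_chain d) v = (dest d == v)%:R - (orig d == v)%:R.
Proof.
case: d => e b; rewrite /net /dest /orig /=.
have h (P : pred E) :
    \sum_(f | P f) edge_chain (e, b) f = if P e then (if b then 1 else -1) else 0.
  rewrite big_mkcond (bigD1 e) //= big1 ?addr0; last first.
    by move=> f fe; rewrite !ffunE /= eq_sym (negPf fe); case: (P f).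
  by rewrite !ffunE /= eqxx.
by rewrite !h; case: b {h}; do 2!case: (_ == v).
Qed.

Lemma is_walk_cons d s v v' :
  is_walk (@src R C) (@tgt R C) v (d :: s) v' =
  (orig d == v) && is_walk (@src R C) (@tgt R C) (dest d) s v'.
Proof. by case: d => e b. Qed.

Lemma net_walk s v v' x : is_walk (@src R C) (@tgt R C) v s v' ->
  net (walk_chain s) x = (v' == x)%:R - (v == x)%:R.
Proof.
rewrite /walk_chain net_sum.
elim: s v => [v|d s IH v]; first by move=> /eqP ->; rewrite big_nil subrr.
rewrite is_walk_cons => /andP[/eqP <- /IH hs].
by rewrite big_cons hs net_edge_chain addrC addrA subrK.
Qed.

Lemma walk_chain_ex v v' : exists c, forall x, net c x = (v' == x)%:R - (v == x)%:R.
Proof.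
have [s hs] := curve_connected v v'.
by exists (walk_chain s) => x; apply: net_walk.
Qed.

(** Summation by parts.  It turns the boundary of a chain into the variation of a
    potential along it; in particular gradients are orthogonal to cycles. *)
Lemma sum_coboundary (F : V -> R) c :
  \sum_e (c e)%:~R * (F (tgt e) - F (src e)) = \sum_v (net c v)%:~R * F v.
Proof.
have h (g : E -> V) :
    \sum_e (c e)%:~R * F (g e) = \sum_v (\sum_(e | g e == v) c e)%:~R * F v.
  rewrite (partition_big g xpredT) //=; apply: eq_bigr => v _.
  rewrite rmorph_sum /= mulr_suml; apply: eq_bigr => e /eqP <- //.
under eq_bigr do rewrite mulrBr.
rewrite sumrB !h -sumrB; apply: eq_bigr => v _.
by rewrite -mulrBl -rmorphB.
Qed.

Lemma sum_coboundary0 (F : V -> R) c : balanced c ->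
  \sum_e (c e)%:~R * (F (tgt e) - F (src e)) = 0.
Proof.
move=> /balancedP bc; rewrite sum_coboundary big1 // => v _.
by rewrite bc mul0r.
Qed.

(** A cochain that is orthogonal to the cycles is a gradient.  The potential at [v]
    is the sum of [k] over any chain from a base vertex to [v]: it depends only on
    the end points because two such chains differ by a cycle. *)
Lemma exact_cochain (k : E -> R) :
  (forall w, \sum_e (w e)%:~R * k e = 0) ->
  exists F : V -> R, forall e, F (tgt e) - F (src e) = k e.
Proof.
move=> hk.
have /card_gt0P[v0 _] := vertex_nonempty C.
have hk' c : (forall v, net c v = 0) -> \sum_e (c e)%:~R * k e = 0.
  by move=> /balancedP bc; apply: (hk (Form bc)).
pose ch v := projT1 (cid (walk_chain_ex v0 v)).
have chP v x : net (ch v) x = (v == x)%:R - (v0 == x)%:R.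
  by rewrite /ch; case: cid.
exists (fun v => \sum_e (ch v e)%:~R * k e) => e.
have /hk' : forall x, net (ch (src e) + edge_chain (e, true) - ch (tgt e)) x = 0.
  move=> x; rewrite netD netN netD net_edge_chain !chP /dest /orig /=; lia.
under eq_bigr do rewrite !ffunE rmorphB rmorphD /= mulrBl mulrDl.
rewrite sumrB big_split /=.
have -> : \sum_f (if e == f then 1 else 0 : int)%:~R * k f = k e.
  rewrite (bigD1 e) //= eqxx mul1r big1 ?addr0 // => f fe.
  by rewrite eq_sym (negPf fe) mul0r.
lra.
Qed.

(** The end of a leaf lies on no other edge, so that the balance condition there
    has a single term. *)
Lemma leaf_form w e : len e = +oo%E -> w e = 0.
Proof.
move=> le; have := leafE e; rewrite le eqxx /valence => /esym/eqP hv.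
have he : (0 < #|[pred f | tgt f == tgt e]|)%N.
  by apply/card_gt0P; exists e; rewrite inE.
have /card_le1P : (#|[pred f | tgt f == tgt e]| <= 1)%N by rewrite -hv leq_addl.
move=> /(_ e); rewrite !inE eqxx => /(_ isT) h1.
have h0 : #|[pred f | src f == tgt e]| = 0%N.
  by move: hv he; set a := #|_|; set b := #|_|; lia.
have : balanced w by exact: (valP w).
move=> /balancedP /(_ (tgt e)); rewrite /net (bigD1 e) //=.
rewrite big1; last first.
  by move=> f /andP[ft fe]; move: (h1 f); rewrite !inE ft (negPf fe).
rewrite big1; last first.
  by move=> f sf; have := card0_eq h0 f; rewrite !inE sf.
by rewrite addr0 subr0.
Qed.

Lemma fine_len_gt0 e : len e != +oo%E -> 0 < fine (len e).
Proof. by move=> le; have := len_gt0 e; case: (len e) le. Qed.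

Lemma len_fineK e : len e != +oo%E -> (fine (len e))%:E = len e.
Proof. by move=> le; have := len_gt0 e; case: (len e) le. Qed.

(** In an integral a length is multiplied by a form, which is 0 on leaves, so that
    giving leaves the length 1 changes no integral.  With finite lengths on all edges
    distances and energies make sense on the whole graph. *)
Definition ell e : R := if len e == +oo%E then 1 else fine (len e).

Lemma ell_gt0 e : 0 < ell e.
Proof. by rewrite /ell; case: ifPn => // /fine_len_gt0. Qed.

Lemma form_ell w e : (w e)%:~R * fine (len e) = (w e)%:~R * ell e.
Proof.
rewrite /ell; case: ifPn => // /eqP le.
by rewrite leaf_form// !mul0r.
Qed.

Definition pairing c : oneform C -> R :=
  fun w => \sum_e (c e)%:~R * (w e)%:~R * ell e.

Lemma integral_cycleE (c : oneform C) : integral_cycle c = pairing c.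
Proof.
apply/funext => w; rewrite /integral_cycle /pairing; apply: eq_bigr => e _.
by rewrite -!mulrA form_ell.
Qed.

Lemma pairingD c c' : pairing (c + c') = pairing c + pairing c'.
Proof.
apply/funext => w; rewrite /pairing [RHS]/GRing.add/= -big_split /=.
by apply: eq_bigr => e _; rewrite ffunE rmorphD /= !mulrDl.
Qed.

Lemma pairingN c : pairing (- c) = - pairing c.
Proof.
apply/funext => w; rewrite /pairing [RHS]/GRing.opp/= -sumrN.
by apply: eq_bigr => e _; rewrite ffunE rmorphN /= !mulNr.
Qed.

Lemma pairing0 : pairing 0 = 0.
Proof.
by apply/funext => w; rewrite /pairing big1 // => e _; rewrite ffunE !mul0r.
Qed.

Lemma pairing_edge_chain d w : pairing (edge_chain d) w = edge_integral d w.
Proof.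
case: d => e b; rewrite /pairing /edge_integral (bigD1 e) //= big1 ?addr0.
  by rewrite ffunE /= eqxx -mulrA -form_ell /sgn mulrA; case: b.
by move=> f fe; rewrite ffunE /= eq_sym (negPf fe) !mul0r.
Qed.

Lemma pairing_walk s w :
  pairing (walk_chain s) w = \sum_(d <- s) edge_integral d w.
Proof.
rewrite /walk_chain; elim: s => [|d s IH]; first by rewrite !big_nil pairing0.
by rewrite !big_cons pairingD -IH -pairing_edge_chain.
Qed.

Lemma latticeP (x : oneform C -> R) :
  lattice x <-> exists2 c, balanced c & x = pairing c.
Proof.
split=> [[c _ <-]|[c bc ->]].
  by exists c; [exact: (valP c)|rewrite integral_cycleE].
by exists (Form bc) => //; rewrite integral_cycleE.
Qed.

Lemma lattice0 : lattice (0 : oneform C -> R).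
Proof. apply/latticeP; exists 0; rewrite ?pairing0 //; exact: rpred0. Qed.

Lemma latticeD (x y : oneform C -> R) : lattice x -> lattice y -> lattice (x + y).
Proof.
move=> /latticeP[c bc ->] /latticeP[c' bc' ->]; apply/latticeP.
exists (c + c'); rewrite ?pairingD //; apply/balancedP => v.
by rewrite netD (balancedP _ bc) (balancedP _ bc') addr0.
Qed.

Lemma latticeN (x : oneform C -> R) : lattice x -> lattice (- x).
Proof.
move=> /latticeP[c bc ->]; apply/latticeP.
exists (- c); rewrite ?pairingN //; apply/balancedP => v.
by rewrite netN (balancedP _ bc) oppr0.
Qed.

(** The left kernel of the transposed boundary matrix consists of the functions that
    are constant along edges.  By connectedness these are the constants, so the
    boundary matrix has rank [#|V| - 1]. *)
Lemma genusE : (genus C)%:Z = #|E|%:Z - #|V|%:Z + 1.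
Proof.
rewrite /genus mxrank_ker; set B := boundary_mx C.
have rB := rank_leq_row B.
have hT : \rank (kermx B^T) = 1%N.
  apply/eqP; rewrite eqn_leq; apply/andP; split; last first.
    rewrite lt0n mxrank_eq0; apply/negP => /eqP k0.
    have : (const_mx 1 : 'rV[rat]_#|V|) *m B^T = 0.
      apply/rowP => i; rewrite !mxE.
      under eq_bigr do rewrite !mxE mul1r.
      rewrite sumrB; apply/eqP; rewrite subr_eq0; apply/eqP.
      have h (v : V) : \sum_(j < #|V|) (v == enum_val j)%:R = 1 :> rat.
        rewrite (bigD1 (enum_rank v)) //= enum_rankK eqxx big1 ?addr0 // => j.
        by rewrite -(inj_eq enum_val_inj) enum_rankK eq_sym => /negPf ->.
      by rewrite !h.
    move/sub_kermxP; rewrite k0 submx0 => /eqP/rowP.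
    have /card_gt0P[v0 _] := vertex_nonempty C.
    by move=> /(_ (enum_rank v0)); rewrite !mxE; apply/eqP; rewrite oner_eq0.
  suff : (kermx B^T <= (const_mx 1 : 'rV[rat]_#|V|))%MS.
    by move=> /mxrankS /leq_trans; apply; apply: rank_leq_row.
  apply/row_subP => i; set x := row i _.
  have hx : x *m B^T = 0 by apply/sub_kermxP; rewrite row_sub.
  clearbody x.
  pose F v := x 0 (enum_rank v).
  have Fe e : F (tgt e) = F (src e).
    have /rowP/(_ (enum_rank e)) := hx; rewrite !mxE.
    under eq_bigr do rewrite !mxE enum_rankK mulrBr.
    have h (v : V) : \sum_(j < #|V|) x 0 j * (v == enum_val j)%:R = F v.
      rewrite (bigD1 (enum_rank v)) //= enum_rankK eqxx mulr1 big1 ?addr0 // => j.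
      rewrite -(inj_eq enum_val_inj) enum_rankK eq_sym => /negPf ->.
      by rewrite mulr0.
    by rewrite sumrB !h => /eqP; rewrite subr_eq0 => /eqP.
  have Fw s v v' : is_walk (@src R C) (@tgt R C) v s v' -> F v = F v'.
    elim: s v => [v /eqP -> //|[e b] s IH v].
    rewrite is_walk_cons => /andP[/eqP <- /IH <-].
    by rewrite /dest /orig /=; case: b; rewrite Fe.
  have /card_gt0P[v0 _] := vertex_nonempty C.
  have -> : x = F v0 *: const_mx 1.
    apply/rowP => j; rewrite !mxE mulr1.
    have [s /Fw ->] := curve_connected v0 (enum_val j).
    by rewrite /F enum_valK.
  exact: scalemx_sub.
have := mxrank_ker B^T; rewrite hT mxrank_tr => h1.
have : (\rank B <= #|V|)%N by exact: rank_leq_col.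
lia.
Qed.

End Chains.

(** * Distance and the theta function *)

Section Metric.
Variables (R : realType) (C : tropical_curve R).
Notation V := (vertex C).
Notation E := (edge C).
Implicit Types (c : {ffun E -> int}) (w : oneform C) (d : E * bool).
Implicit Types (e : E) (v : V) (s : seq (E * bool)).

Definition one_lipschitz (S : pred V) (f : V -> R) : Prop :=
  (forall v, S v -> f v = 0) /\
  forall d, f (dest d) <= f (orig d) + ell d.1.

Lemma one_lipschitz_bounded (S : pred V) v0 v : S v0 ->
  has_ubound [set f v | f in one_lipschitz S].
Proof.
move=> Sv0; have [s hs] := curve_connected v0 v.
exists (\sum_(d <- s) ell d.1) => _ [f [f0 fL] <-].
have -> : \sum_(d <- s) ell d.1 = f v0 + \sum_(d <- s) ell d.1.
  by rewrite (f0 _ Sv0) add0r.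
elim: s v0 {Sv0} hs => [v0 /eqP ->|d s IH v0]; first by rewrite big_nil addr0.
rewrite is_walk_cons => /andP[/eqP <- /IH h].
by rewrite big_cons addrA (le_trans h) // lerD2r.
Qed.

(** The distance to [S], obtained as the largest 1-Lipschitz function that vanishes
    on [S].  At a vertex outside [S] without an incoming edge along which it grows
    at full speed, its value could be increased a little. *)
Lemma distance_potential (S : pred V) v0 : S v0 -> exists2 f, one_lipschitz S f &
  forall v, ~~ S v -> exists2 d, dest d = v & f v = f (orig d) + ell d.1.
Proof.
move=> Sv0; pose f v := sup [set g v | g in one_lipschitz S].
have z : one_lipschitz S (fun=> 0).
  by split=> // d; rewrite add0r ltW // ell_gt0.
have ub g v : one_lipschitz S g -> g v <= f v.
  by move=> hg; apply: (ub_le_sup (one_lipschitz_bounded v Sv0)); exists g.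
have lub v x : (forall g, one_lipschitz S g -> g v <= x) -> f v <= x.
  move=> h; apply: ge_sup; first by exists 0, (fun=> 0).
  by move=> _ [g hg <-]; apply: h.
have fL : one_lipschitz S f.
  split=> [v Sv|d].
    apply/eqP; rewrite eq_le (ub _ _ z) andbT.
    by apply: lub => g [g0 _]; rewrite g0.
  by apply: lub => g hg; case: (hg) => _ /(_ d) /le_trans; apply; rewrite lerD2r ub.
exists f => // v Sv; apply: contrapT => hn.
pose eps := \big[Num.min/1]_(d | dest d == v) (f (orig d) + ell d.1 - f v).
have eps0 : 0 < eps.
  apply: lt_bigmin => // d /eqP hd; rewrite subr_gt0 lt_neqAle.
  rewrite -hd (fL.2 d) andbT; apply/eqP => h; apply: hn; exists d => //.
  by rewrite -hd.
have /(ub _ v) : one_lipschitz S (fun u => f u + (u == v)%:R * eps).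
  split=> [u Su|d].
    rewrite (fL.1 _ Su) add0r; case: eqP Sv => [<-|_ _]; last by rewrite mul0r.
    by rewrite Su.
  case: (eqVneq (dest d) v) => [hd|hd]; rewrite (mul0r, mul1r); last first.
    rewrite addr0 addrAC (le_trans (fL.2 d)) // lerDl.
    by rewrite mulr_ge0 ?ler0n ?ltW.
  case: (eqVneq (orig d) v) => [->|td]; rewrite (mul0r, mul1r).
    by rewrite hd lerDl ltW // ell_gt0.
  have : eps <= f (orig d) + ell d.1 - f v by apply: bigmin_le_cond; rewrite hd.
  by rewrite hd; lra.
by rewrite eqxx mul1r gerDl leNgt eps0.
Qed.

Lemma lip_edge (S : pred V) f e : one_lipschitz S f ->
  `|f (tgt e) - f (src e)| <= ell e.
Proof.
move=> [_ fL]; have := fL (e, true); have := fL (e, false).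
rewrite /dest /orig /= ler_norml => h1 h2.
by apply/andP; split; lra.
Qed.

(** The point of [e] where the shortest routes through its two ends have the same
    length, that is, the maximum on [e] of the distance that [f] measures at the
    vertices. *)
Definition mid (f : V -> R) e : R := (ell e + f (tgt e) - f (src e)) / 2.

Lemma mid_range (S : pred V) f : one_lipschitz S f ->
  forall e, 0 <= mid f e <= ell e.
Proof.
move=> fL e; have := lip_edge e fL; rewrite /mid ler_norml => /andP[h1 h2].
by apply/andP; split; lra.
Qed.

Definition dot c c' : R := \sum_e (c e)%:~R * (c' e)%:~R * ell e.
Definition normsq c : R := dot c c.

Lemma dotDl c1 c2 c : dot (c1 + c2) c = dot c1 c + dot c2 c.
Proof.
rewrite -big_split; apply: eq_bigr => e _ /=.
by rewrite ffunE rmorphD /= !mulrDl.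
Qed.

Lemma dotNl c1 c : dot (- c1) c = - dot c1 c.
Proof.
by rewrite -sumrN; apply: eq_bigr => e _ /=; rewrite ffunE rmorphN /= !mulNr.
Qed.

Lemma dotC c1 c2 : dot c1 c2 = dot c2 c1.
Proof. by apply: eq_bigr => e _; rewrite (mulrC (c1 e)%:~R). Qed.

Lemma dot_edge_chain d c : dot (edge_chain d) c = sgn R d.2 * (c d.1)%:~R * ell d.1.
Proof.
rewrite /dot (bigD1 d.1) //= big1 ?addr0 => [|e he].
  by rewrite !ffunE eqxx; case: d.2.
by rewrite ffunE eq_sym (negPf he) !mul0r.
Qed.

Lemma normsqD c1 c2 : normsq (c1 + c2) = normsq c1 + 2 * dot c1 c2 + normsq c2.
Proof.
rewrite /normsq dotDl ![dot _ (c1 + c2)]dotC !dotDl (dotC c2 c1).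
ring.
Qed.

Lemma normsqN c : normsq (- c) = normsq c.
Proof. by rewrite /normsq dotNl dotC dotNl opprK. Qed.

Lemma normsq_edge_chain d : normsq (edge_chain d) = ell d.1.
Proof.
rewrite /normsq dot_edge_chain ffunE eqxx /sgn; case: d.2 => /=; ring.
Qed.

Section Distance.
Variables (p : V) (f : V -> R).
Hypothesis fL : one_lipschitz (pred1 p) f.
Hypothesis f_tight :
  forall v, v != p -> exists2 d, dest d = v & f v = f (orig d) + ell d.1.

(** The chain only uses edges in the direction of steepest ascent of [f], at most
    once; this is what a shortest path does. *)
Definition conformal_to_gradient c : Prop := forall e,
  [\/ c e = 0, c e = 1 /\ f (tgt e) = f (src e) + ell e |
      c e = -1 /\ f (src e) = f (tgt e) + ell e].

(** A shortest path from [p] to [u], built by following tight edges backwards.  The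
    last clause, that it stays within the ball of radius [f u], ensures that the
    edge added at each step is new, so that its length adds to the energy. *)
Lemma geodesic_chain u : exists c,
  [/\ forall x, net c x = (u == x)%:R - (p == x)%:R,
      normsq c = f u, conformal_to_gradient c &
      forall e, c e != 0 -> f (src e) <= f u /\ f (tgt e) <= f u].
Proof.
have [n] := ubnP #|[pred x | f x < f u]|; elim: n u => // n IH u hn.
have [->|up] := eqVneq u p.
  exists 0; split=> [x||e|e]; rewrite ?net0 ?subrr ?ffunE ?eqxx //.
    by rewrite (fL.1 p) ?inE //; apply: big1 => e _; rewrite ffunE !mul0r.
  by constructor 1; rewrite ?ffunE.
have [d hd fu] := f_tight up.
have ltf : f (orig d) < f u by rewrite fu ltrDl ell_gt0.
have {}/IH[c [cb cn cg cm]] : (#|[pred x | (f x < f (orig d))%R]| < n)%N.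
  rewrite -ltnS; apply: leq_trans hn; rewrite ltnS; apply: proper_card.
  apply/properP; split.
    by apply/fintype.subsetP => x; rewrite !inE => /lt_trans; apply.
  by exists (orig d); rewrite !inE ?ltxx.
have cd0 : c d.1 = 0.
  apply/eqP/negPn/negP => /cm[]; move: hd ltf; rewrite /dest /orig.
  by case: d.2 => ->; lra.
exists (c + edge_chain d); split=> [x||e|e].
- by rewrite netD cb net_edge_chain hd; lia.
- rewrite normsqD dotC dot_edge_chain cd0 cn normsq_edge_chain fu.
  by rewrite mulr0 mul0r mulr0 addr0.
- rewrite !ffunE; case: eqP => [<-|_]; last by rewrite addr0; exact: cg.
  rewrite cd0 add0r; move: hd fu; rewrite /dest /orig; case: d.2 => <- ->.
    by constructor 2.
  by constructor 3.
- rewrite !ffunE; case: (d.1 =P e) => [<- _|_].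
    by move: ltf; rewrite -hd /dest /orig; case: d.2; split; lra.
  by rewrite addr0 => /cm; lra.
Qed.

(** Let [a] be the coefficient of the chain on [e].  The right-hand side is the
    energy of the chain extended by the segment of length [y] of [e], which has
    coefficient [a + 1] on that segment and [a] on the rest of [e].  The left-hand
    side is the distance from [p] to the end of the segment.  Summation by parts
    expresses that distance as the total variation of [f] along the chain, and on
    each edge the variation is at most the energy, [f] being 1-Lipschitz and
    coefficients being integers. *)
Lemma energy_ge c e (y : R) : 0 <= y <= ell e ->
  (forall x, net c x = (src e == x)%:R - (p == x)%:R) ->
  f (src e) + mid f e - `|y - mid f e| <= normsq c + (2 * (c e)%:~R + 1) * y.
Proof.
move=> /andP[y0 yl] cb.
have hs : \sum_e (c e)%:~R * (f (tgt e) - f (src e)) = f (src e).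
  rewrite sum_coboundary; under eq_bigr do rewrite cb rmorphB /= mulrBl.
  rewrite sumrB (bigD1 (src e)) //= eqxx mul1r [X in _ + X - _]big1; last first.
    by move=> v; rewrite eq_sym => /negPf ->; rewrite mul0r.
  rewrite addr0 (bigD1 p) //= eqxx mul1r big1; last first.
    by move=> v; rewrite eq_sym => /negPf ->; rewrite mul0r.
  by rewrite (fL.1 p) ?inE // addr0 subr0.
have term e' : 0 <= (c e')%:~R * (c e')%:~R * ell e' -
    (c e')%:~R * (f (tgt e') - f (src e')).
  have l0 := ell_gt0 e'; move: (lip_edge e' fL); set D := f _ - f _.
  rewrite ler_norml => /andP[h1 h2]; move: (c e') => a.
  have [a0|a0] := leP 0 a.
    have [->|a1] := eqVneq a 0; first by rewrite !mul0r subrr.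
    have : (1 : R) <= a%:~R by rewrite ler1z; lia.
    move: (a%:~R : R) => b b1.
    by rewrite -mulrA -mulrBr mulr_ge0 //; [lra|nra].
  have : (a%:~R : R) <= -1 by rewrite -(rmorphN1 intr) ler_int; lia.
  move: (a%:~R : R) => b b1.
  by rewrite -mulrA -mulrBr mulr_le0 //; [lra|nra].
have : normsq c - f (src e) >= (c e)%:~R * (c e)%:~R * ell e -
    (c e)%:~R * (f (tgt e) - f (src e)).
  have -> : normsq c - f (src e) = \sum_e' ((c e')%:~R * (c e')%:~R * ell e' -
      (c e')%:~R * (f (tgt e') - f (src e'))) by rewrite sumrB hs.
  by rewrite (bigD1 e) //= lerDl; apply: sumr_ge0 => e' _.
have h1 : f (src e) + mid f e - `|y - mid f e| <= f (src e) + y.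
  by have := ler_norm (mid f e - y); rewrite distrC; lra.
have h2 : f (src e) + mid f e - `|y - mid f e| <= f (tgt e) + ell e - y.
  by have := ler_norm (y - mid f e); rewrite /mid; lra.
have l0 := ell_gt0 e; move: (lip_edge e fL); set D := f _ - f _.
rewrite ler_norml => /andP[h3 h4]; move: (c e) => a.
have [a0|a0] := leP 0 a.
  have [->|a1] := eqVneq a 0; first by rewrite /=; lra.
  have : (1 : R) <= a%:~R by rewrite ler1z; lia.
  move: (a%:~R : R) => b b1 hn.
  have : 0 <= b * (b * ell e - D) by apply: mulr_ge0; nra.
  nra.
have hb : (a%:~R : R) <= -1 by rewrite -(rmorphN1 intr) ler_int; lia.
(* For [a = -1] the bound on the distance through the target of [e] is sharp; for
   smaller [a] there is room. *)
have [a1|a1] := eqVneq a (-1).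
  by rewrite a1 /= /D; lra.
have {}hb : (a%:~R : R) <= -2 by rewrite -[-2](rmorphN intr 2) ler_int; lia.
move: (a%:~R : R) hb => b hb hn.
have hfe : f (tgt e) = D + f (src e) by rewrite /D subrK.
have : 0 <= (- b - 1) * ((- b - 1) * ell e + D + 2 * (ell e - y)).
  by apply: mulr_ge0; nra.
rewrite hfe in h2; nra.
Qed.

(** Before the midpoint of [e] the shortest path goes through the source of [e], after
    it through the target, with [e] run backwards.  In both cases the geodesic
    chain cannot use [e] in the direction that would make the energy too large:
    the other end of [e] would then be outside its ball. *)
Lemma energy_attained e (y : R) : 0 <= y <= ell e ->
  exists2 c, (forall x, net c x = (src e == x)%:R - (p == x)%:R) &
  normsq c + (2 * (c e)%:~R + 1) * y <= f (src e) + mid f e - `|y - mid f e|.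
Proof.
move=> /andP[y0 yl]; have l0 := ell_gt0 e.
have [ym|ym] := leP y (mid f e).
  have [c [cb cn cg cm]] := geodesic_chain (src e).
  exists c => //; rewrite cn ler0_norm ?subr_le0 //.
  suff : (c e)%:~R <= (0 : R) by move: (c e)%:~R => b; nra.
  rewrite lerz0; case: (cg e) => [->//|[c1 h]|[->]//].
  have /cm[_] : c e != 0 by rewrite c1.
  by rewrite h gerDl leNgt l0.
have [c [cb cn cg cm]] := geodesic_chain (tgt e).
exists (c - edge_chain (e, true)).
  by move=> x; rewrite netD netN net_edge_chain cb /dest /orig /=; lia.
rewrite normsqD normsqN normsq_edge_chain dotC dotNl dot_edge_chain cn !ffunE /= eqxx.
rewrite gtr0_norm ?subr_gt0 // rmorphB /= /mid mul1r.
suff : 0 <= (c e)%:~R :> R by move: (c e)%:~R => b; nra.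
rewrite ler0z; case: (cg e) => [->//|[->]//|[c1 h]].
have /cm[+ _] : c e != 0 by rewrite c1.
by rewrite h gerDl leNgt l0.
Qed.

(** Completing the square: twice the expression that Theta maximizes over the cycles
    [l] is the energy of [c], extended by the segment of length [y] of [e], minus that
    of [c - l] with the same extension, and [c - l] runs through all integral chains
    with the same end points. *)
Lemma ThetaE c e (y : R) : 0 <= y <= ell e ->
  (forall x, net c x = (src e == x)%:R - (p == x)%:R) ->
  Theta (fun w => pairing c w + y * (w e)%:~R) =
  2^-1 * normsq c + ((c e)%:~R + 2^-1) * y -
  2^-1 * (f (src e) + mid f e - `|y - mid f e|).
Proof.
move=> hy cb; rewrite /Theta /Q; set A := [set _ | _ in _]; set M := RHS.
have val (l : oneform C) :
    pairing c l + y * (l e)%:~R - 2^-1 * integral_cycle l l =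
    2^-1 * normsq c + ((c e)%:~R + 2^-1) * y -
    2^-1 * (normsq (c - l) + (2 * ((c - l : {ffun E -> int}) e)%:~R + 1) * y).
  rewrite integral_cycleE normsqD normsqN dotC dotNl dotC !ffunE rmorphB /=.
  have -> : pairing c l = dot c l by [].
  have -> : pairing l l = normsq l by [].
  by lra.
have AM : ubound A M.
  move=> _ [l _ <-]; rewrite val lerD2l lerN2 ler_pM2l ?invr_gt0 ?ltr0n //.
  apply: energy_ge => // x; rewrite netD netN cb.
  by have /balancedP -> : balanced l := valP l; rewrite subr0.
apply/eqP; rewrite eq_le; apply/andP; split.
  by apply: ge_sup => //; eexists; exists 0.
have [c' cb' hc'] := energy_attained hy.
have bl : balanced (c - c').
  by apply/balancedP => x; rewrite netD netN cb cb' subrr.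
have : A (pairing c (Form bl) + y * ((Form bl) e)%:~R
          - 2^-1 * integral_cycle (Form bl) (Form bl)) by exists (Form bl).
move=> /(ub_le_sup (ex_intro _ M AM)); apply: le_trans; rewrite val.
rewrite /= subKr.
by rewrite lerD2l lerN2 ler_pM2l ?invr_gt0 ?ltr0n.
Qed.

End Distance.
End Metric.

(** * Cycles modulo 2 *)

Section Euler.
Variables (R : realType) (C : tropical_curve R).
Notation V := (vertex C).
Notation E := (edge C).
Implicit Types (c : {ffun E -> int}) (d : E * bool) (e : E) (v : V).

(** Follow the flow [c] from [e0]: if one could not return to the origin of [e0], the
    set of vertices reached would be entered by [e0] and left by nothing, against
    the balance of [c].  A path of oriented edges without repetition then closes up
    to the cycle. *)
Lemma conformal_cycle c e0 : balanced c -> c e0 != 0 -> exists z,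
  [/\ balanced z, z e0 != 0 & forall e, z e = 0 \/ z e = Num.sg (c e)].
Proof.
move=> bc ce0.
pose dir e := (e, 0 < c e).
pose pos d := (d == dir d.1) && (c d.1 != 0).
pose r := [rel d d' | pos d' && (dest d == orig d')].
set d0 := dir e0.
pose A v := [exists d, connect r d0 d && (dest d == v)].
have Aext d : pos d -> A (orig d) -> A (dest d).
  move=> pd /existsP[d' /andP[cd /eqP hd]]; apply/existsP; exists d.
  by rewrite eqxx andbT (connect_trans cd) // connect1 //= pd hd /=.
have Ad0 : A (dest d0) by apply/existsP; exists d0; rewrite connect0 eqxx.
have : A (orig d0).
  apply: contrapT => nA.
  have := sum_coboundary0 (fun v => (A v)%:R : R) bc.
  apply/eqP; rewrite gt_eqF //.
  have ge0 e : 0 <= (c e)%:~R * ((A (tgt e))%:R - (A (src e))%:R) :> R.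
    have := Aext (dir e); rewrite /pos /dir /dest /orig /= eqxx /=.
    have [cn|cp|->] := ltgtP (c e) 0; last by rewrite mul0r.
      move=> /(_ isT) h; rewrite mulr_le0 ?lerz0 ?(ltW cn) // subr_le0 ler_nat.
      by case: (A (tgt e)) h => // ->.
    move=> /(_ isT) h; rewrite mulr_ge0 ?ler0z ?(ltW cp) // subr_ge0 ler_nat.
    by case: (A (src e)) h => // ->.
  rewrite (bigD1 e0) //= ltr_pwDl //; last by apply: sumr_ge0.
  rewrite lt_neqAle ge0 andbT eq_sym mulf_neq0 ?intr_eq0 // subr_eq0.
  move: Ad0 nA; rewrite /d0 /dir /dest /orig /=.
  by case: (0 < c e0) => /= -> /negP/negPf ->; rewrite ?oner_eq0 // eq_sym oner_eq0.
move=> /existsP[d1 /andP[/connectP[s0 sp0 ->] /eqP]].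
case/shortenP: sp0 => s sp su _ hlast.
have pall d t : path r d t -> all pos t.
  by elim: t d => //= d' t IH d /andP[/andP[-> _] /IH].
have pwalk d t : path r d t ->
    is_walk (@src R C) (@tgt R C) (dest d) t (dest (last d t)).
  elim: t d => [|d' t IH] d; first by rewrite /= eqxx.
  by move=> /andP[/andP[_ /eqP h] /IH]; rewrite is_walk_cons h eqxx.
have allpos : all pos (d0 :: s).
  rewrite /= {1}/pos eqxx ce0 /=.
  by apply: pall sp.
exists (walk_chain (d0 :: s)).
have entry e : walk_chain (d0 :: s) e =
    if dir e \in d0 :: s then Num.sg (c e) else 0.
  rewrite /walk_chain sum_ffunE.
  have h d : d \in d0 :: s -> edge_chain d e = if d == dir e then Num.sg (c e) else 0.
    move=> /(allP allpos) /andP[/eqP dE cd]; rewrite ffunE.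
    have -> : (d == dir e) = (d.1 == e).
      by apply/eqP/eqP => [->//|<-].
    case: eqP => // <-; rewrite dE /=.
    by case: (ltgtP (c d.1) 0) cd => // h _; [rewrite ltr0_sg|rewrite gtr0_sg].
  rewrite (eq_big_seq _ h); case: ifP => hin; last first.
    rewrite big1_seq // => d /andP[_]; case: eqP => // ->.
    by rewrite hin.
  rewrite (bigD1_seq (dir e)) //= eqxx big1 ?addr0 // => d /negPf ->.
  by [].
split.
- apply/balancedP => x.
  have /net_walk -> : is_walk (@src R C) (@tgt R C) (orig d0) (d0 :: s) (orig d0).
    by rewrite is_walk_cons eqxx /= -hlast pwalk.
  by rewrite subrr.
- by rewrite entry inE eqxx /= sgr_eq0.
- by move=> e; rewrite entry; case: ifP; [right|left].
Qed.

(** While some coefficient exceeds 1 in absolute value, subtracting twice a conformal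
    cycle through that edge decreases the sum of the absolute values: [|a|] becomes
    [||a| - 2|], which is no larger for [a <> 0] and smaller for [|a| >= 2]. *)
Lemma mod2_representative c : balanced c -> exists g c',
  [/\ balanced g, balanced c', c = g + (c' + c') & forall e, `|g e| <= 1].
Proof.
have [n] := ubnP (\sum_e `|c e|)%N; elim: n c => // n IH c hn bc.
have [/forallP h|] := boolP [forall e, `|c e| <= 1].
  exists c, 0; split=> //; last by rewrite !addr0.
  by apply/balancedP => v; rewrite net0.
rewrite negb_forall => /existsP[e0 he0].
have ce0 : c e0 != 0 by apply: contraNneq he0 => ->.
have [z [bz ze0 hz]] := conformal_cycle bc ce0.
have [||g [c' [bg bc' cE hg]]] := IH (c - (z + z)).
- rewrite -ltnS; apply: leq_trans hn; rewrite ltnS.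
  have le_int (a b : int) : b = 0 \/ b = Num.sg a -> (`|(a - (b + b))%R| <= `|a|)%N.
    by case=> ->; last case: (sgrP a) => //; lia.
  have lt_int (a b : int) : b = Num.sg a -> ~~ (`|a|%R <= 1) ->
      (`|(a - (b + b))%R| < `|a|)%N.
    by move=> ->; case: (sgrP a) => //; lia.
  rewrite (bigD1 e0) // [X in (_ < X)%N](bigD1 e0) //= -addSn leq_add //.
    by rewrite !ffunE; apply: lt_int => //; case: (hz e0) ze0 => ->.
  by apply: leq_sum => e _; rewrite !ffunE; apply: le_int.
- apply/balancedP => v.
  by rewrite netD netN netD (balancedP _ bc) (balancedP _ bz) !addr0.
exists g, (c' + z); split=> //.
  by apply/balancedP => v; rewrite netD (balancedP _ bc') (balancedP _ bz).
by rewrite -[LHS](subrK (z + z)) cE -addrA [c' + z + _]addrACA.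
Qed.

End Euler.

(** * Piecewise linear functions and their slopes *)

Section Germs.
Variable R : realType.
Implicit Types (g : R -> R) (k : R).

(** Being exactly linear near 0 on the right is stronger than having a right
    derivative, and it holds for piecewise linear functions.  Unlike the limits, it
    is stable under the usual operations without side conditions. *)
Definition germ g k : Prop :=
  exists2 eps, 0 < eps & forall h, 0 <= h <= eps -> g h = g 0 + k * h.

(** The sign makes [k] the slope out of the point at infinity, back into the leaf. *)
Definition end_germ g k : Prop :=
  exists B, forall y, B <= y -> g y = g B - k * (y - B).

Lemma rderiv0_germ g k : germ g k -> rderiv0 g = k.
Proof.
move=> [eps eps0 gE]; rewrite /rderiv0; apply/cvg_lim => //.
apply: cvg_near_cst; near=> h.
have h0 : 0 < h by near: h; exact: nbhs_right_gt.
rewrite gE; last first.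
  apply/andP; split; first exact: ltW.
  by near: h; exact: nbhs_right_ltW.
by rewrite addrAC subrr add0r mulfK // gt_eqF.
Unshelve. all: by end_near. Qed.

Lemma end_germ_slope g k :
  end_germ g k -> - lim (derive1 g x @[x --> +oo]) = k.
Proof.
move=> [B gE]; apply/eqP; rewrite eqr_oppLR; apply/eqP; apply/cvg_lim => //.
apply: cvg_near_cst; near=> x.
have Bx : B < x by near: x; apply: nbhs_pinfty_gt; rewrite num_real.
rewrite /derive1; apply/cvg_lim => //; apply: cvg_near_cst; near=> h.
have h0 : h != 0 by near: h; exact: nbhs_dnbhs_neq.
have Bh : B <= h + x.
  have : `|h| < x - B.
    near: h; apply: dnbhs0_lt; by rewrite subr_gt0.
  by rewrite ltr_norml => /andP[]; lra.
rewrite (gE (h + x)) // (gE x) ?ltW // /GRing.scale /=.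
have -> : g B - k * (h + x - B) - (g B - k * (x - B)) = h * - k by ring.
by rewrite mulKf.
Unshelve. all: by end_near. Qed.

Lemma germ_ext g g' k : g =1 g' -> germ g k -> germ g' k.
Proof.
move=> e [eps eps0 h]; exists eps => // x hx.
by rewrite -!e h.
Qed.

Lemma germD g g' k k' :
  germ g k -> germ g' k' -> germ (fun x => g x + g' x) (k + k').
Proof.
move=> [e e0 h] [e' e0' h']; exists (Num.min e e'); first by rewrite lt_min e0.
move=> x; rewrite le_min => /and3P[x0 xe xe'].
rewrite (h x) ?x0 // (h' x) ?x0 //=; ring.
Qed.

Lemma germN g k : germ g k -> germ (fun x => - g x) (- k).
Proof. by move=> [e e0 h]; exists e => // x /h ->; ring. Qed.

Lemma end_germD g g' k k' :
  end_germ g k -> end_germ g' k' -> end_germ (fun x => g x + g' x) (k + k').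
Proof.
move=> [B h] [B' h']; exists (Num.max B B') => y.
set M := Num.max B B' => My.
have [MB MB'] : B <= M /\ B' <= M by rewrite !le_max !lexx orbT.
rewrite (h y) ?(h' y) ?(h M) ?(h' M) ?(le_trans _ My) //; ring.
Qed.

Lemma end_germN g k : end_germ g k -> end_germ (fun x => - g x) (- k).
Proof. by move=> [B h]; exists B => x /h ->; ring. Qed.

Lemma germ_unique g k k' : germ g k -> germ g k' -> k = k'.
Proof. by move=> /rderiv0_germ <- /rderiv0_germ. Qed.

(** The condition that [PL] imposes on a single edge, of length [l]. *)
Definition piecewise (l : \bar R) g : Prop := exists breaks : seq R,
  forall x y, 0 <= x -> x <= y -> (y%:E <= l)%E ->
  (forall b, b \in breaks -> ~~ (x < b < y)) ->
  exists n : int, forall z, x <= z <= y -> g z = g x + n%:~R * (z - x).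

(** In the second case of the last clause fewer breaks remain between [y] and [y0]
    than between [x] and [y0], which allows induction on their number. *)
Lemma next_break (breaks : seq R) x y0 : x < y0 ->
  exists y, [/\ x < y <= y0, forall b, b \in breaks -> ~~ (x < b < y) &
    y = y0 \/ y \in breaks].
Proof.
elim: breaks => [|b bs IH] xy; first by exists y0; split; rewrite ?xy ?lexx //; left.
have [y [/andP[xy' yy0] hy hor]] := IH xy.
have [bxy|bxy] := boolP (x < b < y).
  move/andP: bxy => [xb by_]; exists b; split.
  - by rewrite xb ltW // (lt_le_trans by_).
  - move=> b'; rewrite inE => /orP[/eqP ->|/hy]; first by rewrite ltxx andbF.
    by apply: contra => /andP[-> /lt_trans ->].
  - by right; rewrite inE eqxx.
exists y; split; first by rewrite xy'.
  by move=> b'; rewrite inE => /orP[/eqP ->|/hy].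
by case: hor => [|h]; [left|right; rewrite inE h orbT].
Qed.

Lemma avoid_right (breaks : seq R) x y0 : x < y0 ->
  exists2 y, x < y <= y0 & forall b, b \in breaks -> ~~ (x < b < y).
Proof. by move=> /(next_break breaks)[y [? ? _]]; exists y. Qed.

Lemma avoid_left (breaks : seq R) x y0 : y0 < x ->
  exists2 y, y0 <= y < x & forall b, b \in breaks -> ~~ (y < b < x).
Proof.
move=> yx; have [|y /andP[h1 h2] hb] := @avoid_right (map -%R breaks) (- x) (- y0).
  by rewrite ltrN2.
exists (- y); first by rewrite lerNr h2 ltrNl h1.
move=> b bb; have := hb (- b); rewrite map_f // => /(_ isT).
by apply: contra => /andP[h3 h4]; rewrite ltrN2 h4 ltrNl h3.
Qed.

Lemma room_right (l : \bar R) x : (x%:E < l)%E ->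
  exists2 y, x < y & (y%:E <= l)%E.
Proof.
case: l => [r| |] //; first by rewrite lte_fin => xr; exists r.
by move=> _; exists (x + 1); rewrite ?ltrDl ?ltr01 // leey.
Qed.

Lemma piecewise_right l g x : piecewise l g -> 0 <= x -> (x%:E < l)%E ->
  exists n : int, germ (fun h => g (x + h)) n%:~R.
Proof.
move=> [bs hbs] x0 xl.
have [y0 xy0 y0l] := room_right xl.
have [y /andP[xy yy0] hb] := avoid_right bs xy0.
have [n hn] : exists n : int, forall z, x <= z <= y -> g z = g x + n%:~R * (z - x).
  apply: hbs => //; first exact: ltW.
  by rewrite (le_trans _ y0l) // lee_fin.
exists n, (y - x); first by rewrite subr_gt0.
move=> h /andP[h0 hy]; rewrite addr0 hn; first by rewrite (addrC x) addrK.
by rewrite lerDl h0 /= addrC -lerBrDr.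
Qed.

Lemma piecewise_left l g x : piecewise l g -> 0 < x -> (x%:E <= l)%E ->
  exists n : int, germ (fun h => g (x - h)) n%:~R.
Proof.
move=> [bs hbs] x0 xl.
have [y /andP[y0 yx] hb] := avoid_left bs x0.
have [n hn] : exists n : int, forall z, y <= z <= x -> g z = g y + n%:~R * (z - y).
  by apply: hbs => //; exact: ltW.
exists (- n), (x - y); first by rewrite subr_gt0.
move=> h /andP[h0 hy]; rewrite subr0 (hn x) ?lexx ?ltW // (hn (x - h)).
  by rewrite rmorphN /=; ring.
by rewrite gerBl h0 andbT lerBrDr addrC -lerBrDr.
Qed.

Lemma seq_bounded (bs : seq R) :
  exists2 B, 0 <= B & forall b, b \in bs -> b <= B.
Proof.
exists (\big[Num.max/0]_(b <- bs) b) => [|b hb]; last exact: le_bigmax_seq.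
by elim/big_rec: _ => // b x _ h; rewrite le_max h orbT.
Qed.

Lemma piecewise_end g : piecewise +oo%E g ->
  exists n : int, end_germ g n%:~R.
Proof.
move=> [bs hbs]; have [B B0 Bb] := seq_bounded bs.
have lin y : B <= y ->
    exists n : int, forall z, B <= z <= y -> g z = g B + n%:~R * (z - B).
  move=> By; apply: hbs => //; first by rewrite leey.
  by move=> b /Bb; rewrite leNgt => /negPf ->.
(* The slope is read off on [B, B + 1]; all larger intervals contain it. *)
have [n hn] := lin (B + 1) ltac:(by rewrite lerDl ler01).
exists (- n), B => y By; have [|n' hn'] := lin (Num.max y (B + 1)).
  by rewrite le_max By.
have -> : g y = g B + n'%:~R * (y - B) by apply: hn'; rewrite By le_max lexx.
have : g B + n%:~R * (B + 1 - B) = g B + n'%:~R * (B + 1 - B).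
  rewrite -hn ?lexx ?lerDl ?ler01 // -hn' // lerDl ler01 le_max lexx orbT //.
by rewrite addrAC subrr add0r !mulr1 => /addrI h; rewrite rmorphN /= h; ring.
Qed.

Lemma piecewiseD l g g' :
  piecewise l g -> piecewise l g' -> piecewise l (fun x => g x + g' x).
Proof.
move=> [bs h] [bs' h']; exists (bs ++ bs') => x y x0 xy yl hb.
have [|n hn] := h x y x0 xy yl; first by move=> b bb; apply: hb; rewrite mem_cat bb.
have [|n' hn'] := h' x y x0 xy yl.
  by move=> b bb; apply: hb; rewrite mem_cat bb orbT.
exists (n + n') => z hz; rewrite (hn _ hz) (hn' _ hz) rmorphD /=; ring.
Qed.

Lemma piecewiseN l g : piecewise l g -> piecewise l (fun x => - g x).
Proof.
move=> [bs h]; exists bs => x y x0 xy yl hb.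
have [n hn] := h x y x0 xy yl hb.
by exists (- n) => z hz; rewrite (hn _ hz) rmorphN /=; ring.
Qed.

End Germs.

Section Slopes.
Variables (R : realType) (C : tropical_curve R).
Notation V := (vertex C).
Notation E := (edge C).
Notation point := (curve_point C).
Implicit Types (f : point -> R) (p : point) (d : E * bool) (e : E) (k : R).
Implicit Types (D : divisor C).

Lemma chart_le0 e x : x <= 0 -> chart e x = inl (src e).
Proof. by rewrite /chart => ->. Qed.

Lemma chart_inner (q : inner C) : chart (val q).1 (val q).2 = inr q.
Proof.
case: q => [[e x] h] /=; rewrite /chart; have /andP[x0 xl] := h.
rewrite leNgt x0 /=; case: insubP => [u _ uE|]; last by rewrite h.
by congr inr; apply/val_inj.
Qed.

Lemma chart_tgt e x : 0 < x -> (len e <= x%:E)%E -> chart e x = inl (tgt e).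
Proof.
move=> x0 lx; rewrite /chart leNgt x0 /= insubF //= x0 /=.
by apply/negbTE; rewrite -leNgt.
Qed.

Lemma chart_inr e x : 0 < x -> (x%:E < len e)%E ->
  exists2 q : inner C, val q = (e, x) & chart e x = inr q.
Proof.
move=> x0 xl; have h : (0 < (e, x).2) && ((e, x).2%:E < len (e, x).1)%E by rewrite x0.
by exists (Sub (e, x) h); rewrite ?SubK // -chart_inner SubK.
Qed.

Definition edge_fun f e : R -> R := fun x => f (chart e x).

(** The three cases follow the definition of [slope], with germs for limits. *)
Definition has_slope f p d k : Prop :=
  match p with
  | inl v =>
      if d.2 then germ (fun h => edge_fun f d.1 h) k
      else if len d.1 == +oo%E then end_germ (edge_fun f d.1) k
      else germ (fun h => edge_fun f d.1 (fine (len d.1) - h)) k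
  | inr q => germ (fun h => edge_fun f d.1 ((val q).2 + sgn R d.2 * h)) k
  end.

Lemma slopeE f p d k : has_slope f p d k -> slope f p d = k.
Proof.
case: p d => [v|q] [e b] /=; last exact: rderiv0_germ.
case: b; first exact: rderiv0_germ.
by case: ifP => _; [exact: end_germ_slope|exact: rderiv0_germ].
Qed.

Lemma has_slopeD f f' p d k k' : has_slope f p d k -> has_slope f' p d k' ->
  has_slope (fun x => f x + f' x) p d (k + k').
Proof.
case: p d => [v|q] [e b] /=; last exact: germD.
by case: b; [exact: germD|case: ifP => _; [exact: end_germD|exact: germD]].
Qed.

Lemma has_slopeN f p d k : has_slope f p d k ->
  has_slope (fun x => - f x) p d (- k).
Proof.
case: p d => [v|q] [e b] /=; last exact: germN.
by case: b; [exact: germN|case: ifP => _; [exact: end_germN|exact: germN]].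
Qed.

Lemma PLE f : PL f <-> forall e, piecewise (len e) (edge_fun f e).
Proof. by []. Qed.

Lemma PL_slope f p d : PL f -> d \in tangents p ->
  exists n : int, has_slope f p d n%:~R.
Proof.
move=> /PLE fPL; case: p d => [v|q] [e b] /= hd.
  case: b {hd}.
    have [|n /germ_ext hn] := piecewise_right (fPL e) (lexx 0).
      exact: len_gt0.
    by exists n; apply: hn => h; rewrite add0r.
  have [le|le] := eqVneq (len e) +oo%E.
    by have := fPL e; rewrite le => /piecewise_end.
  apply: piecewise_left (fPL e) (fine_len_gt0 le) _.
  by rewrite len_fineK.
have [x0 xl] := andP (valP q).
move: hd; rewrite !inE => /orP[] /eqP[-> ->].
  have [n /germ_ext hn] := piecewise_right (fPL _) (ltW x0) xl.
  by exists n; apply: hn => h; rewrite mul1r.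
have [n /germ_ext hn] := piecewise_left (fPL _) x0 (ltW xl).
by exists n; apply: hn => h; rewrite mulN1r.
Qed.

Lemma PL_D f f' : PL f -> PL f' -> PL (fun x => f x + f' x).
Proof. by move=> h h' e; apply: piecewiseD (h e) (h' e). Qed.

Lemma PL_N f : PL f -> PL (fun x => - f x).
Proof. by move=> h e; apply: piecewiseN (h e). Qed.

Lemma slopeD f f' p d : PL f -> PL f' -> d \in tangents p ->
  slope (fun x => f x + f' x) p d = slope f p d + slope f' p d.
Proof.
move=> h h' hd; have [n hn] := PL_slope h hd; have [n' hn'] := PL_slope h' hd.
by rewrite (slopeE hn) (slopeE hn') (slopeE (has_slopeD hn hn')).
Qed.

Lemma slopeN f p d : PL f -> d \in tangents p ->
  slope (fun x => - f x) p d = - slope f p d.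
Proof.
move=> h hd; have [n hn] := PL_slope h hd.
by rewrite (slopeE hn) (slopeE (has_slopeN hn)).
Qed.

Lemma principalD D D' : principal D -> principal D' -> principal (D + D').
Proof.
move=> [f h hf] [f' h' hf']; exists (fun x => f x + f' x); first exact: PL_D.
move=> p; rewrite coeffD rmorphD /= hf hf' -big_split /=.
by rewrite big_seq [RHS]big_seq; apply: eq_bigr => d hd; rewrite slopeD.
Qed.

Lemma principalN D : principal D -> principal (- D).
Proof.
move=> [f h hf]; exists (fun x => - f x); first exact: PL_N.
move=> p; rewrite coeffN rmorphN /= hf -sumrN.
by rewrite big_seq [RHS]big_seq; apply: eq_bigr => d hd; rewrite slopeN.
Qed.

Lemma lin_equiv_sym D D' : lin_equiv D D' -> lin_equiv D' D.
Proof. by move=> /principalN; rewrite /lin_equiv opprB. Qed.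

Lemma lin_equiv_trans D1 D2 D3 :
  lin_equiv D1 D2 -> lin_equiv D2 D3 -> lin_equiv D1 D3.
Proof. by move=> /principalD h /h; rewrite /lin_equiv addrA subrK. Qed.

Lemma lin_equiv_dclass D D' : lin_equiv D D' -> dclass D = dclass D'.
Proof.
move=> h; apply/seteqP; split=> D1 /= h1; apply: (lin_equiv_trans h1) => //.
exact: lin_equiv_sym.
Qed.

End Slopes.

(** * Abel's theorem *)

Section DivisorSums.
Variables (R : realType) (K : choiceType).
Implicit Types (D : {freeg K / int}) (F : K -> R).

Definition dsum F D : R := \sum_(p <- dom D) (coeff p D)%:~R * F p.

Lemma dsum_sub F D (s : seq K) : uniq s -> {subset dom D <= s} ->
  dsum F D = \sum_(p <- s) (coeff p D)%:~R * F p.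
Proof.
move=> us sub; rewrite /dsum [RHS](bigID (fun p => p \in dom D)) /=.
rewrite [X in _ + X]big1 ?addr0 => [|p hp]; last first.
  by rewrite coeff_outdom // mul0r.
rewrite -[RHS]big_filter; apply: perm_big; apply: uniq_perm.
- exact: uniq_dom.
- exact: filter_uniq.
- by move=> p; rewrite mem_filter andb_idr // => /sub.
Qed.

Lemma dsumD F D D' : dsum F (D + D') = dsum F D + dsum F D'.
Proof.
set s := undup (dom D ++ dom D').
have us : uniq s by exact: undup_uniq.
rewrite !(@dsum_sub _ _ s) //; try by move=> x hx; rewrite mem_undup mem_cat hx ?orbT.
  rewrite -big_split; apply: eq_bigr => p _ /=.
  by rewrite coeffD rmorphD /= mulrDl.
by move=> x /domD_subset; rewrite mem_undup.
Qed.

Lemma dsumN F D : dsum F (- D) = - dsum F D.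
Proof.
rewrite (@dsum_sub _ _ (dom D)) ?uniq_dom // => [|x]; last by rewrite domN.
rewrite -sumrN; apply: eq_bigr => p _.
by rewrite coeffN rmorphN /= mulNr.
Qed.

Lemma dsum_add F G D : dsum (fun p => F p + G p) D = dsum F D + dsum G D.
Proof. by rewrite /dsum -big_split; apply: eq_bigr => p _; rewrite mulrDr. Qed.

Lemma dsum_scale a F D : dsum (fun p => a * F p) D = a * dsum F D.
Proof. by rewrite /dsum mulr_sumr; apply: eq_bigr => p _; rewrite mulrCA. Qed.

Lemma dsum_opp F D : dsum (fun p => - F p) D = - dsum F D.
Proof. by rewrite /dsum -sumrN; apply: eq_bigr => p _; rewrite mulrN. Qed.

Lemma dsum_exchange (I : finType) (P : pred I) (G : I -> K -> R) D :
  dsum (fun p => \sum_(i | P i) G i p) D = \sum_(i | P i) dsum (G i) D.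
Proof.
rewrite /dsum exchange_big /=.
by apply: eq_bigr => p _; rewrite mulr_sumr.
Qed.

Lemma eq_dsum F G D : F =1 G -> dsum F D = dsum G D.
Proof. by move=> e; apply: eq_bigr => p _; rewrite e. Qed.

Lemma dsum0 F : dsum F 0 = 0.
Proof. by rewrite /dsum dom0 big_nil. Qed.

Lemma dsumU F p : dsum F << p >> = F p.
Proof. by rewrite /dsum domU1 big_seq1 coeffU eqxx mulr1 mul1r. Qed.

Lemma dsum_sum F (I : Type) (r : seq I) (G : I -> {freeg K / int}) :
  dsum F (\sum_(i <- r) G i) = \sum_(i <- r) dsum F (G i).
Proof. by elim/big_rec2: _ => [|i y x _ <-]; rewrite ?dsum0 ?dsumD. Qed.

Lemma dsum_deg D : dsum (fun=> 1) D = (deg D)%:~R.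
Proof.
rewrite -{2}(freeg_sumE D) raddf_sum rmorph_sum /=; apply: eq_bigr => p _.
by rewrite degU mulr1.
Qed.

Lemma dsum_pick D p : dsum (fun q => (q == p)%:R) D = (coeff p D)%:~R.
Proof.
have [pD|pD] := boolP (p \in dom D); last first.
  rewrite coeff_outdom // /dsum big1_seq // => q /andP[_ qD].
  by case: eqP qD pD => [-> ->//|_ _ _]; rewrite mulr0.
rewrite /dsum (bigD1_seq p) ?uniq_dom //= eqxx mulr1 big1 ?addr0 // => q.
by move=> /negPf ->; rewrite mulr0.
Qed.

End DivisorSums.

Section GermCalculus.
Variable R : realType.
Implicit Types (g : R -> R) (k : R).

Lemma germ_affine (a k : R) : germ (fun h => a + k * h) k.
Proof. by exists 1 => // h _; rewrite mulr0 addr0. Qed.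

Lemma germZ a g k : germ g k -> germ (fun h => a * g h) (a * k).
Proof. by move=> [e e0 h]; exists e => // x /h ->; ring. Qed.

Lemma germ_sum (I : Type) (r : seq I) (G : I -> R -> R) (k : I -> R) :
  (forall i, germ (G i) (k i)) ->
  germ (fun h => \sum_(i <- r) G i h) (\sum_(i <- r) k i).
Proof.
move=> hG; elim: r => [|i r IH].
  rewrite big_nil; apply: (@germ_ext _ (fun h => 0 + 0 * h)).
    by move=> h /=; rewrite big_nil mul0r addr0.
  exact: germ_affine.
rewrite big_cons; apply: (germ_ext _ (germD (hG i) IH)).
by move=> h /=; rewrite big_cons.
Qed.

Lemma germ_local g g' k eps : 0 < eps ->
  (forall h, 0 <= h <= eps -> g h = g' h) -> germ g k -> germ g' k.
Proof.
move=> eps0 e [eps' eps'0 h]; exists (Num.min eps eps').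
  by rewrite lt_min eps0.
move=> x /andP[x0]; rewrite le_min => /andP[x1 x2].
by rewrite -!e ?lexx ?x0 ?x1 ?ltW // h // x0.
Qed.

Lemma germ_min_right (x b : R) : germ (fun h => Num.min (x + h) b) (x < b)%R%:R.
Proof.
have [xb|bx] := ltP x b.
  exists (b - x); first by rewrite subr_gt0.
  move=> h /andP[h0 hb]; rewrite addr0 mul1r !min_l //; lra.
exists 1 => // h /andP[h0 _]; rewrite addr0 mul0r addr0 !min_r //; lra.
Qed.

Lemma germ_min_left (x b : R) : germ (fun h => Num.min (x - h) b) (- (x <= b)%R%:R).
Proof.
have [xb|bx] := leP x b.
  exists 1 => // h /andP[h0 hb]; rewrite subr0 mulN1r !min_l //; lra.
exists (x - b); first by rewrite subr_gt0.
move=> h /andP[h0 hb]; rewrite subr0 oppr0 mul0r addr0 !min_r //; lra.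
Qed.

Lemma germ_dist_right (x b : R) :
  germ (fun h => `|x + h - b|) (if b <= x then 1 else -1).
Proof.
case: leP => [bx|xb].
  exists 1 => // h /andP[h0 _]; rewrite addr0 !ger0_norm; lra.
exists (b - x); first by rewrite subr_gt0.
move=> h /andP[h0 hb]; rewrite addr0 !ler0_norm; lra.
Qed.

Lemma germ_dist_left (x b : R) :
  germ (fun h => `|x - h - b|) (if x <= b then 1 else -1).
Proof.
have := germ_dist_right (- x) (- b); rewrite lerN2.
by apply: germ_ext => h; rewrite -normrN; congr `| _ |; ring.
Qed.

Lemma piecewise_ext l g g' : (forall y, 0 <= y -> (y%:E <= l)%E -> g y = g' y) ->
  piecewise l g -> piecewise l g'.
Proof.
move=> e [bs h]; exists bs => x y x0 xy yl hb.
have [n hn] := h x y x0 xy yl hb; exists n => z /andP[xz zy].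
have zl : (z%:E <= l)%E by rewrite (le_trans _ yl) // lee_fin.
rewrite -!e // ?(le_trans x0) //; first by apply: hn; rewrite xz.
by rewrite (le_trans _ yl) // lee_fin.
Qed.

Lemma piecewise_affine l (a : R) (n : int) : piecewise l (fun h => a + n%:~R * h).
Proof. by exists [::] => x y _ _ _ _; exists n => z _; ring. Qed.

Lemma piecewise_min l (b : R) : piecewise l (fun y => Num.min y b).
Proof.
exists [:: b] => x y _ xy _ /(_ b); rewrite inE eqxx => /(_ isT).
rewrite negb_and -!leNgt => /orP[bx|yb].
  by exists 0 => z /andP[xz _]; rewrite mul0r addr0 !min_r //; apply: le_trans xz.
exists 1 => z /andP[xz zy]; rewrite mul1r !min_l; lra.
Qed.

Lemma piecewiseZ l g (n : int) : piecewise l g -> piecewise l (fun y => n%:~R * g y).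
Proof.
move=> [bs h]; exists bs => x y x0 xy yl hb.
have [m hm] := h x y x0 xy yl hb.
by exists (n * m) => z hz; rewrite (hm _ hz) rmorphM /=; ring.
Qed.

Lemma piecewise_sum (I : Type) (r : seq I) l (G : I -> R -> R) :
  (forall i, piecewise l (G i)) ->
  piecewise l (fun h => \sum_(i <- r) G i h).
Proof.
move=> hG; elim: r => [|i r IH].
  apply: (@piecewise_ext _ (fun h => 0 + 0%:~R * h)).
    by move=> h /= _ _; rewrite big_nil mul0r addr0.
  exact: piecewise_affine.
apply: (piecewise_ext _ (piecewiseD (hG i) IH)).
by move=> h /= _ _; rewrite big_cons.
Qed.

End GermCalculus.

Section AbelJacobi.
Variables (R : realType) (C : tropical_curve R).
Notation V := (vertex C).
Notation E := (edge C).
Notation point := (curve_point C).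
Implicit Types (p q : point) (e : E) (v : V) (D : divisor C) (w : oneform C).

Lemma sum_tangents v (G : E * bool -> R) :
  \sum_(d <- tangents (inl v : point)) G d =
  \sum_(e | src e == v) G (e, true) + \sum_(e | tgt e == v) G (e, false).
Proof. by rewrite /tangents big_cat !big_map !big_filter !big_enum_cond. Qed.

(** The chosen lift of [mu] comes from a walk, of which only the underlying chain
    matters. *)
Lemma mu_chain p0 p : exists2 c : {ffun E -> int},
  forall x, net c x = (anchor p == x)%:R - (anchor p0 == x)%:R &
  forall w, mu p0 p w = anchor_integral p w - anchor_integral p0 w + pairing c w.
Proof.
rewrite /mu; case: xgetP => [_ -> [s hs <-]|hn].
  exists (walk_chain s) => [x|w]; first exact: net_walk.
  by rewrite /path_integral pairing_walk.
have [s hs] := curve_connected (anchor p0) (anchor p).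
by case: (hn (path_integral p0 p s)); exists s.
Qed.

Lemma abel_jacobiE p0 D w : abel_jacobi p0 D w = dsum (fun p => mu p0 p w) D.
Proof. by []. Qed.

Lemma abel_jacobiD p0 D D' :
  abel_jacobi p0 (D + D') = abel_jacobi p0 D + abel_jacobi p0 D'.
Proof. by apply/funext => w; rewrite [RHS]/GRing.add /= !abel_jacobiE dsumD. Qed.

Lemma abel_jacobiN p0 D : abel_jacobi p0 (- D) = - abel_jacobi p0 D.
Proof. by apply/funext => w; rewrite [RHS]/GRing.opp /= !abel_jacobiE dsumN. Qed.

(** At vertices [pos] has a default value, which is only ever multiplied by [on]. *)
Definition on e p : bool := if p is inr q then (val q).1 == e else false.
Definition pos p : R := if p is inr q then (val q).2 else 0.

Lemma on_pos e p : on e p -> 0 < pos p /\ ((pos p)%:E < len e)%E.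
Proof. by case: p => // q /= /eqP <-; exact: andP (valP q). Qed.

Lemma on_pos_eq (q : inner C) p :
  on (val q).1 p -> pos p = (val q).2 -> p = inr q.
Proof.
case: p => // q'; case: q q' => [[e x] h] [[e' x'] h'] /= /eqP e1 e2.
by congr inr; apply/val_inj; rewrite /= e1 e2.
Qed.

(** Injectivity of the Abel-Jacobi map.  Join [p0] to the points of [D] by paths.  The
    sum of the paths, with multiplicities, is a 1-chain with boundary [D], since [D]
    has degree 0.  Subtracting the cycle [l] that represents its integrals makes it
    orthogonal to all cycles, hence minus the gradient of a function [f], which is
    piecewise linear with divisor [D].  Here [N] records the part of the chain that is
    constant along each edge; a point at position [b] of [e] contributes also the
    segment from the source of [e] to itself, whose integral up to [y] is
    [Num.min y b]. *)
Theorem abel p0 D : deg D = 0 -> lattice (abel_jacobi p0 D) -> principal D.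
Proof.
move=> degD /latticeP[l bl AJ].
pose ch q := projT1 (cid2 (mu_chain p0 q)).
have chb q x : net (ch q) x = (anchor q == x)%:R - (anchor p0 == x)%:R.
  by rewrite /ch; case: cid2.
have chE q w :
    mu p0 q w = anchor_integral q w - anchor_integral p0 w + pairing (ch q) w.
  by rewrite /ch; case: cid2.
pose N : {ffun E -> int} := \sum_(q <- dom D) ch q *~ coeff q D - l.
have NE e : (N e)%:~R = dsum (fun q => (ch q e)%:~R) D - (l e)%:~R :> R.
  rewrite !ffunE rmorphB /= sum_ffunE rmorph_sum /=; congr (_ - _).
  by apply: eq_bigr => q _; rewrite chain_mulz rmorphM mulrC.
have dsum0deg x : dsum (fun=> x) D = 0 :> R.
  have := dsum_deg R D; rewrite degD => h0.
  by rewrite -[x]mulr1 dsum_scale h0 mulr0.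
have Nb x : (net N x)%:~R = dsum (fun q => (anchor q == x)%:R) D :> R.
  rewrite netD netN (balancedP _ bl) subr0 net_sum rmorph_sum /=.
  transitivity (dsum (fun q => (anchor q == x)%:R - (anchor p0 == x)%:R) D : R).
    apply: eq_bigr => q _; rewrite netMz chb rmorphM rmorphB /= mulrC.
    by rewrite !mulrz_nat.
  by rewrite dsum_add dsum0deg addr0.
have key w : dsum (fun q => anchor_integral q w) D + pairing N w = 0.
  have := congr1 (fun g => g w) AJ; rewrite abel_jacobiE.
  rewrite (eq_dsum (G := fun q => _) D (fun q => chE q w)).
  rewrite dsum_add dsum_add dsum0deg addr0.
  have -> : pairing N w = dsum (fun q => pairing (ch q) w) D - pairing l w.
    rewrite /pairing dsum_exchange -sumrB; apply: eq_bigr => e _.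
    rewrite NE !mulrBl; congr (_ - _).
    rewrite -mulrA mulrC -dsum_scale; apply: eq_dsum => q.
    by rewrite mulrC mulrA.
  by move=> h; rewrite addrA h subrr.
pose k e : R := (N e)%:~R * ell e + dsum (fun q => (on e q)%:R * pos q) D.
have [|F FE] := @exact_cochain _ _ (fun e => - k e).
  move=> w; under eq_bigr do rewrite mulrN mulrDr.
  rewrite sumrN big_split /=.
  have -> : \sum_e (w e)%:~R * ((N e)%:~R * ell e) = pairing N w.
    by apply: eq_bigr => e _; rewrite mulrCA mulrA.
  have -> : \sum_e (w e)%:~R * dsum (fun q => (on e q)%:R * pos q) D =
      dsum (fun q => anchor_integral q w) D.
    under eq_bigr do rewrite -dsum_scale.
    rewrite -dsum_exchange; apply: eq_dsum => -[v|q] /=.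
      by rewrite big1 // => e _; rewrite mul0r mulr0.
    rewrite (bigD1 (val q).1) //= eqxx mul1r big1 ?addr0 // => e.
    by rewrite eq_sym => /negPf ->; rewrite mul0r mulr0.
  by rewrite addrC key oppr0.
pose along e (y : R) :=
  F (src e) - (N e)%:~R * y - dsum (fun q => (on e q)%:R * Num.min y (pos q)) D.
pose f (p : point) := match p with
  | inl v => F v | inr q => along (val q).1 (val q).2 end.
have fE e y : 0 <= y -> (y%:E <= len e)%E -> edge_fun f e y = along e y.
  rewrite le_eqVlt => /predU1P[<- _|y0].
    rewrite /edge_fun chart_le0 //= /along mulr0 subr0.
    rewrite (eq_dsum (G := fun=> 0)) ?dsum0deg ?subr0 // => q.
    case: (boolP (on e q)) => [/on_pos[/ltW h _]|_]; last by rewrite mul0r.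
    by rewrite min_l // mulr0.
  rewrite le_eqVlt => /orP[/eqP yl|yl]; last first.
    by have [q qE hq] := chart_inr y0 yl; rewrite /edge_fun hq /f qE.
  rewrite /edge_fun chart_tgt // ?yl //= /along.
  have -> : y = ell e by rewrite /ell -yl.
  have := FE e; rewrite /k => /eqP; rewrite subr_eq addrC => /eqP ->.
  rewrite opprD addrA; congr (_ - _); apply: eq_dsum => q.
  case: (boolP (on e q)) => [/on_pos[_]|_]; last by rewrite !mul0r.
  by rewrite -yl lte_fin => h; rewrite min_r // /ell -yl /= ltW.
have fPL : PL f.
  apply/PLE => e; apply: (piecewise_ext (g := along e)) => [y y0 yl|].
    by rewrite fE.
  rewrite /along /dsum; apply: piecewiseD; last first.
    apply: piecewiseN; apply: piecewise_sum => q; apply: piecewiseZ.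
    apply: (piecewise_ext (g := fun y => ((on e q)%:R : int)%:~R * Num.min y (pos q))).
      by move=> y _ _; rewrite mulrz_nat.
    by apply: piecewiseZ; exact: piecewise_min.
  apply: (piecewise_ext (g := fun y => F (src e) + (- N e)%:~R * y)) => [y _ _|].
    by rewrite rmorphN mulNr.
  exact: piecewise_affine.
have right e x : 0 <= x -> (x%:E < len e)%E ->
    germ (fun h => edge_fun f e (x + h))
      (- (N e)%:~R - dsum (fun q => (on e q)%:R * (x < pos q)%R%:R) D).
  move=> x0 xl; have [y0 xy0 y0l] := room_right xl.
  apply: (@germ_local _ (fun h => along e (x + h)) _ _ (y0 - x)).
  - by rewrite subr_gt0.
  - move=> h /andP[h0 hy]; rewrite fE ?addr_ge0 //.
    by apply: le_trans y0l; rewrite lee_fin addrC -lerBrDr.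
  - rewrite /along /dsum; apply: germD.
      apply: germ_ext (germ_affine (F (src e) - (N e)%:~R * x) _) => h /=.
      by ring.
    apply: germN; apply: germ_sum => q; do 2 apply: germZ.
    exact: germ_min_right.
have left e x : 0 < x -> (x%:E <= len e)%E ->
    germ (fun h => edge_fun f e (x - h))
      ((N e)%:~R + dsum (fun q => (on e q)%:R * (x <= pos q)%R%:R) D).
  move=> x0 xl.
  apply: (@germ_local _ (fun h => along e (x - h)) _ _ x) => //.
  - move=> h /andP[h0 hy]; rewrite fE ?subr_ge0 //.
    by apply: le_trans xl; rewrite lee_fin gerBl.
  - have -> : dsum (fun q => (on e q)%:R * (x <= pos q)%R%:R) D =
        - dsum (fun q => (on e q)%:R * - (x <= pos q)%R%:R) D :> R.
      by rewrite -dsum_opp; apply: eq_dsum => q; rewrite mulrN opprK.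
    rewrite /along /dsum; apply: germD.
      apply: germ_ext (germ_affine (F (src e) - (N e)%:~R * x) _) => h /=.
      by ring.
    apply: germN; apply: germ_sum => q; do 2 apply: germZ.
    exact: germ_min_left.
have ends e : len e = +oo%E -> end_germ (edge_fun f e) (N e)%:~R.
  move=> le; have [B B0 hB] := seq_bounded (map pos (dom D)).
  have Bb q : q \in dom D -> pos q <= B by move=> hq; exact/hB/map_f.
  exists B => y By; rewrite !fE ?le ?leey //; last exact: le_trans By.
  rewrite /along.
  have -> : dsum (fun q => (on e q)%:R * Num.min y (pos q)) D =
            dsum (fun q => (on e q)%:R * Num.min B (pos q)) D :> R.
    apply: eq_big_seq => q /Bb h; rewrite !min_r // (le_trans h) //.
  by ring.
exists f => // -[v|q].
  rewrite sum_tangents.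
  have -> : \sum_(e | src e == v) slope f (inl v) (e, true) =
      \sum_(e | src e == v) (- (N e)%:~R - dsum (fun q => (on e q)%:R) D).
    apply: eq_bigr => e _.
    rewrite (slopeE (k := - (N e)%:~R - dsum (fun q => (on e q)%:R) D)) //=.
    have := right e 0 (lexx 0) (len_gt0 e).
    rewrite (eq_dsum (G := fun q => (on e q)%:R)) => [|q]; last first.
      case: (boolP (on e q)) => [/on_pos[-> _]|_]; rewrite ?mul0r ?mulr1 //.
    by apply: germ_ext => h; rewrite add0r.
  have -> : \sum_(e | tgt e == v) slope f (inl v) (e, false) =
      \sum_(e | tgt e == v) (N e)%:~R.
    apply: eq_bigr => e _; rewrite (slopeE (k := (N e)%:~R)) //=.
    case: ifPn => [/eqP /ends //|le].
    have := left e _ (fine_len_gt0 le).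
    rewrite len_fineK // lexx => /(_ isT).
    rewrite (eq_dsum (G := fun=> 0)) ?dsum0deg ?addr0 // => q.
    case: (boolP (on e q)) => [/on_pos[_]|_]; last by rewrite mul0r.
    by rewrite -(len_fineK le) lte_fin ltNge => /negPf ->; rewrite mulr0.
  rewrite sumrB sumrN -dsum_exchange.
  transitivity ((net N v)%:~R -
      dsum (fun q => \sum_(e | src e == v) (on e q)%:R) D : R).
    rewrite Nb -dsum_opp -dsum_add -dsum_pick; apply: eq_dsum => -[u|q] /=.
      by rewrite big1 // subr0.
    rewrite big_mkcond (bigD1 (val q).1) //= eqxx big1 ?addr0; last first.
      by move=> e; rewrite eq_sym => /negPf ->; case: ifP.
    by case: ifP => _; rewrite subrr.
  by rewrite /net rmorphB /= !rmorph_sum /=; ring.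
have /andP[x0 xl] := valP q.
rewrite /tangents !big_cons big_nil addr0.
rewrite (slopeE (p := inr q) (d := ((val q).1, true)) 
  (k := - (N (val q).1)%:~R -
    dsum (fun q' => (on (val q).1 q')%:R * ((val q).2 < pos q')%R%:R) D));
  last first.
  by apply: germ_ext (right _ _ (ltW x0) xl) => h /=; rewrite mul1r.
rewrite (slopeE (p := inr q) (d := ((val q).1, false)) 
  (k := (N (val q).1)%:~R +
    dsum (fun q' => (on (val q).1 q')%:R * ((val q).2 <= pos q')%R%:R) D));
  last first.
  by apply: germ_ext (left _ _ x0 (ltW xl)) => h /=; rewrite mulN1r.
rewrite -dsum_pick [RHS]addrC addrACA subrr add0r -dsum_opp -dsum_add.
apply: eq_dsum => q'; rewrite -mulrBr.
have [->|qq] := eqVneq q' (inr q).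
  by rewrite /= eqxx mul1r lexx ltxx subr0.
case: (boolP (on _ _)) => [on1|_]; last by rewrite mul0r.
have : pos q' != (val q).2.
  by apply: contraNneq qq => h; apply/eqP; apply: on_pos_eq.
by rewrite mul1r; case: ltgtP => // _ _; rewrite subrr.
Qed.

End AbelJacobi.

(** * Divisors of orientations *)

Section OrientationDivisor.
Variables (R : realType) (C : tropical_curve R).
Notation V := (vertex C).
Notation E := (edge C).
Notation point := (curve_point C).
Implicit Types (p q : point) (e : E) (v : V) (D : divisor C) (w : oneform C).

(** Unlike the chart, it reaches the end of a leaf, at [y = ell e]; the other points
    of the leaf are the real ones at distance less than 1. *)
Definition edge_point e (y : R) : point :=
  if y == ell e then inl (tgt e) else chart e y.

Lemma leaf_unique e e' : len e = +oo%E ->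
  (tgt e' = tgt e -> e' = e) /\ src e' != tgt e.
Proof.
move=> le; have := leafE e; rewrite le eqxx => /esym/eqP ve.
split; last by apply/eqP => h; move: (src_not_leaf e'); rewrite h ve.
move: ve; rewrite /valence => hv h.
have he : (0 < #|[pred f | tgt f == tgt e]|)%N.
  by apply/card_gt0P; exists e; rewrite inE.
have /card_le1_eqP : (#|[pred f | tgt f == tgt e]| <= 1)%N by rewrite -hv leq_addl.
by apply; rewrite inE ?h.
Qed.

Lemma edge_pointP e (y : R) : 0 <= y <= ell e ->
  [\/ y = 0 /\ edge_point e y = inl (src e),
      y = ell e /\ edge_point e y = inl (tgt e) |
      0 < y < ell e /\ exists2 q : inner C, val q = (e, y) & edge_point e y = inr q].
Proof.
move=> /andP[y0 yl]; rewrite /edge_point; have l0 := ell_gt0 e.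
have [->|yne] := eqVneq y (ell e); first by constructor 2.
have {yne}yl : y < ell e by rewrite lt_neqAle yne.
move: y0; rewrite le_eqVlt => /predU1P[<-|y0].
  by constructor 1; rewrite chart_le0.
constructor 3; split; first by rewrite y0.
have [|q qE hq] := chart_inr (e := e) y0; last by exists q.
move: yl; rewrite /ell; case: ifPn => [/eqP -> _|le]; first by rewrite ltry.
by rewrite -[in X in _ -> X](len_fineK le) lte_fin.
Qed.

Lemma lattice_sum (I : Type) (r : seq I) (P : pred I) (G : I -> oneform C -> R) :
  (forall i, P i -> lattice (G i)) -> lattice (\sum_(i <- r | P i) G i).
Proof.
move=> h; elim/big_rec: _ => [|i x Pi hx]; first exact: lattice0.
by apply: latticeD => //; exact: h.
Qed.

Definition form_at (e : E) : oneform C -> R := fun w => (w e)%:~R.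

(** The chains underlying [mu] at the two points, together with the segment between
    them, form a cycle. *)
Lemma mu_edge_point p0 e (y : R) : 0 <= y <= ell e ->
  lattice (mu p0 (edge_point e y) - mu p0 (inl (src e)) - y \*o form_at e).
Proof.
move=> hy; have [c cb cE] := mu_chain p0 (inl (src e)).
have [c' cb' cE'] := mu_chain p0 (edge_point e y).
case: (edge_pointP hy) => [[-> hp]|[yl hp]|[_ [q qE hp]]].
- apply/latticeP; exists 0; first by apply/balancedP => x; rewrite net0.
  rewrite pairing0 hp subrr sub0r; apply/funext => w.
  by rewrite [LHS]/GRing.opp /= mul0r oppr0.
- apply/latticeP; exists (c' - c - edge_chain (e, true)).
    apply/balancedP => x; rewrite !netD !netN cb cb' net_edge_chain hp /dest /orig /=.
    lia.
  apply/funext => w; rewrite !pairingD !pairingN.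
  rewrite /GRing.add /GRing.opp /= pairing_edge_chain cE cE' hp /=.
  rewrite /edge_integral /sgn /= mul1r form_ell yl /form_at.
  by ring.
- apply/latticeP; exists (c' - c).
    by apply/balancedP => x; rewrite netD netN cb cb' hp /= qE subrr.
  apply/funext => w; rewrite !pairingD !pairingN.
  rewrite /GRing.add /GRing.opp /= cE cE' hp /= qE /= /form_at.
  by ring.
Qed.

(** The divisor of (indegree - 1) for the orientation of each edge towards its marked
    point, on the graph subdivided at the marked points. *)
Definition marked_divisor (m : E -> R) : divisor C :=
  \sum_e << edge_point e (m e) >> - \sum_v << inl v >>.

Lemma deg_marked m : deg (marked_divisor m) = (genus C)%:Z - 1.
Proof.
have h (I : finType) (G : I -> point) : deg (\sum_i << G i >> : divisor C) = #|I|%:Z.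
  rewrite raddf_sum /= (eq_bigr (fun=> 1)) => [|i _]; last by rewrite degU.
  by rewrite sumr_const natz.
by rewrite degB !h genusE addrK.
Qed.

Lemma abel_jacobi_marked p0 (m : E -> R) : (forall e, 0 <= m e <= ell e) ->
  lattice (abel_jacobi p0 (marked_divisor m) -
    (\sum_e (mu p0 (inl (src e)) + m e \*o form_at e) - \sum_v mu p0 (inl v))).
Proof.
move=> hm.
have -> : abel_jacobi p0 (marked_divisor m) =
    \sum_e mu p0 (edge_point e (m e)) - \sum_v mu p0 (inl v).
  apply/funext => w; rewrite abel_jacobiE dsumD dsumN !dsum_sum.
  under eq_bigr do rewrite dsumU.
  under [X in _ - X]eq_bigr do rewrite dsumU.
  by rewrite [RHS]/GRing.add /= [X in _ = _ + X]/GRing.opp /= !fct_sumE.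
rewrite opprB addrA subrK -sumrB; apply: lattice_sum => e _.
by rewrite opprD addrA; exact: mu_edge_point.
Qed.

Section Coefficients.
Variable m : E -> R.
Hypothesis m_range : forall e, 0 <= m e <= ell e.

Lemma coeff_marked p : coeff p (marked_divisor m) =
  \sum_e (edge_point e (m e) == p)%:R - \sum_v ((inl v : point) == p)%:R.
Proof.
have h (I : finType) (G : I -> point) :
    coeff p (\sum_i << G i >> : divisor C) = \sum_i (G i == p)%:R.
  by rewrite raddf_sum /=; apply: eq_bigr => i _; rewrite coeffU mul1r.
by rewrite coeffB !h.
Qed.

Lemma coeff_marked_vertex v : coeff (inl v) (marked_divisor m) =
  \sum_(e | src e == v) (m e == 0)%:R + \sum_(e | tgt e == v) (m e == ell e)%:R - 1.
Proof.
rewrite coeff_marked; congr (_ - _); last first.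
  rewrite (bigD1 v) //= eqxx big1 ?addr0 // => u uv.
  by rewrite (inj_eq inl_inj) (negPf uv).
rewrite [X in _ = X + _]big_mkcond [X in _ = _ + X]big_mkcond -big_split /=.
apply: eq_bigr => e _; have l0 := ell_gt0 e.
case: (edge_pointP (m_range e)) => [[-> ->]|[-> ->]|[/andP[h1 h2] [q _ ->]]].
- rewrite eqxx (inj_eq inl_inj) lt_eqF //.
  by case: (src e == v); case: (tgt e == v).
- rewrite eqxx (inj_eq inl_inj) (gt_eqF l0).
  by case: (src e == v); case: (tgt e == v).
- by rewrite (gt_eqF h1) (lt_eqF h2) !if_same.
Qed.

(** On a leaf the chart has points beyond the artificial length 1, which must not be
    confused with the mark at its end. *)
Lemma coeff_marked_inner (q : inner C) :
  (forall e, len e = +oo%E -> m e = ell e) ->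
  coeff (inr q) (marked_divisor m) =
  ((len (val q).1 != +oo%E) && (m (val q).1 == (val q).2))%:R.
Proof.
move=> m_leaf; rewrite coeff_marked [X in _ - X]big1 ?subr0 //.
rewrite (bigD1 (val q).1) //= [X in _ + X]big1 ?addr0; last first.
  move=> e eq; case: (edge_pointP (m_range e)) => [[_ ->]|[_ ->]|[_ [q' qE ->]]] //.
  by case: eqP => // -[h]; move: eq; rewrite -h qE eqxx.
have /andP[x0 xl] := valP q.
have [le|le] := eqVneq (len (val q).1) +oo%E.
  by rewrite /edge_point m_leaf // eqxx.
have xe : (val q).2 < ell (val q).1.
  by rewrite /ell (negPf le) -lte_fin len_fineK.
case: (edge_pointP (m_range (val q).1)) => [[-> ->]|[-> ->]|[_ [q' qE ->]]] /=.
- by rewrite (lt_eqF x0).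
- by rewrite (gt_eqF xe).
- congr (_ : bool)%:R; apply/eqP/eqP => [[<-]|h]; first by rewrite qE.
  congr inr; apply/val_inj; rewrite qE h.
  by rewrite -surjective_pairing.
Qed.

End Coefficients.
End OrientationDivisor.

(** * The theta divisor of a vertex *)

Section DistanceFunction.
Variables (R : realType) (C : tropical_curve R).
Notation V := (vertex C).
Notation E := (edge C).
Variables (S : pred V) (f : V -> R).
Hypothesis fL : one_lipschitz S f.
Hypothesis f_tight :
  forall v, ~~ S v -> exists2 d, dest d = v & f v = f (orig d) + ell d.1.
Hypothesis S_finite : forall e, len e = +oo%E -> ~~ S (tgt e).

(** The tight edge into the end of a leaf can only be the leaf itself. *)
Lemma leaf_tight (e : E) : len e = +oo%E -> f (tgt e) = f (src e) + ell e.
Proof.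
move=> le; have [[e' b]] := f_tight (S_finite le).
have [h1 h2] := leaf_unique e' le.
rewrite /dest /orig; case: b => /= [/h1 -> //|h].
by move: h2; rewrite h eqxx.
Qed.

Lemma mid_leaf (e : E) : len e = +oo%E -> mid f e = ell e.
Proof. by move=> /leaf_tight; rewrite /mid => ->; field. Qed.

End DistanceFunction.

Section ThetaDivisor.
Variables (R : realType) (C : tropical_curve R).
Notation V := (vertex C).
Notation E := (edge C).
Notation point := (curve_point C).
Variables (p : V) (f : V -> R).
Hypothesis fL : one_lipschitz (pred1 p) f.
Hypothesis f_tight :
  forall v, v != p -> exists2 d, dest d = v & f v = f (orig d) + ell d.1.
Hypothesis p_finite : forall e, len e = +oo%E -> tgt e != p.

(** By [ThetaE] the function is affine with slope [c e + 1/2], plus half the distance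
    to the midpoint; the two halves add up to 1 or 0. *)
Lemma germ_Theta_right (c : {ffun E -> int}) e (x : R) :
  (forall y, net c y = (src e == y)%:R - (p == y)%:R) ->
  0 <= x -> x < ell e ->
  germ (fun h => Theta (fun w => pairing c w + (x + h) * (w e)%:~R))
    ((c e)%:~R + (mid f e <= x)%R%:R).
Proof.
move=> cb x0 xl.
apply: (@germ_local _ (fun h =>
  (2^-1 * normsq c - 2^-1 * (f (src e) + mid f e) + ((c e)%:~R + 2^-1) * x)
  + ((c e)%:~R + 2^-1) * h + 2^-1 * `|x + h - mid f e|) _ _ (ell e - x)).
- by rewrite subr_gt0.
- move=> h /andP[h0 hl].
  rewrite (ThetaE fL f_tight (c := c)) //; first by ring.
  by rewrite addr_ge0 //= addrC -lerBrDr.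
- have -> : (c e)%:~R + (mid f e <= x)%R%:R = ((c e)%:~R + 2^-1) +
      2^-1 * (if mid f e <= x then 1 else -1) :> R.
    by case: ifP => _ /=; field.
  apply: germD; first exact: germ_affine.
  exact/germZ/germ_dist_right.
Qed.

Lemma germ_Theta_left (c : {ffun E -> int}) e (x : R) :
  (forall y, net c y = (src e == y)%:R - (p == y)%:R) ->
  0 < x -> x <= ell e ->
  germ (fun h => Theta (fun w => pairing c w + (x - h) * (w e)%:~R))
    (- (c e)%:~R - 1 + (x <= mid f e)%R%:R).
Proof.
move=> cb x0 xl.
apply: (@germ_local _ (fun h =>
  (2^-1 * normsq c - 2^-1 * (f (src e) + mid f e) + ((c e)%:~R + 2^-1) * x)
  + (- ((c e)%:~R + 2^-1)) * h + 2^-1 * `|x - h - mid f e|) _ _ x) => //.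
- move=> h /andP[h0 hl].
  rewrite (ThetaE fL f_tight (c := c)) //; first by ring.
  by rewrite subr_ge0 hl /= (le_trans _ xl) // gerBl.
- have -> : - (c e)%:~R - 1 + (x <= mid f e)%R%:R = - ((c e)%:~R + 2^-1) +
      2^-1 * (if x <= mid f e then 1 else -1) :> R.
    by case: ifP => _ /=; field.
  apply: germD; first exact: germ_affine.
  exact/germZ/germ_dist_left.
Qed.

(** At a vertex the slopes of the affine parts add up to the boundary of the chain [c],
    which gives the terms -1 at the vertex and +1 at [p], and each edge marked at this
    vertex adds 1.  In the interior of an edge only the kink at the midpoint remains.
    On leaves the function is constant. *)
Lemma theta_divisor_distance p0 :
  is_theta_divisor p0 (mu p0 (inl p)) (marked_divisor (mid f) + << inl p >>).
Proof.
move=> x; have [c1 cb1 cE1] := mu_chain p0 (inl p).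
have [c2 cb2 cE2] := mu_chain p0 x.
pose c := c2 - c1.
have cb y : net c y = (anchor x == y)%:R - (p == y)%:R.
  by rewrite netD netN cb1 cb2 /=; lia.
have cE (d : E * bool) : (fun h => Theta (fun w =>
      mu p0 x w + h * dmu d w - mu p0 (inl p) w)) =
    (fun h => Theta (fun w => anchor_integral x w + pairing c w + h * dmu d w)).
  apply/funext => h; congr Theta; apply/funext => w.
  rewrite cE1 cE2 pairingD pairingN [(_ + _) w]/GRing.add /= [(- _) w]/GRing.opp /=.
  by ring.
under eq_bigr do rewrite cE.
have sumz (P : pred E) (b : E -> bool) :
    (\sum_(e | P e) (b e)%:R)%:~R = \sum_(e | P e) (b e)%:R :> R.
  by rewrite rmorph_sum; apply: eq_bigr => e _; rewrite /= mulrz_nat.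
rewrite coeffD coeffU mul1r rmorphD /= mulrz_nat.
case: x cb2 cE2 @c cb cE => [v|q] cb2 cE2 c cb _.
  rewrite sum_tangents coeff_marked_vertex; last exact: mid_range fL.
  rewrite (inj_eq inl_inj).
  rewrite [X in _ = X + _](eq_bigr (fun e =>
      (c e)%:~R + (mid f e == 0)%:R)) => [|e /eqP sv]; last first.
    rewrite (rderiv0_germ (k := (c e)%:~R + (mid f e <= 0)%R%:R)).
      by have /andP[h _] := mid_range fL e; rewrite eq_le h andbT.
    apply: germ_ext (germ_Theta_right (c := c) _ (lexx 0) (ell_gt0 e))
      => [h|y].
      congr Theta; apply/funext => w.
      by rewrite /dmu /sgn /= mul1r add0r add0r.
    by rewrite cb /= sv.
  rewrite [X in _ = _ + X](eq_bigr (fun e =>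
      - (c e)%:~R + (mid f e == ell e)%:R)) => [|e /eqP tv]; last first.
    rewrite (rderiv0_germ (k := - (c e)%:~R + (ell e <= mid f e)%R%:R)).
      by have /andP[_ h] := mid_range fL e; rewrite eq_le h.
    have -> : - (c e)%:~R =
        - ((c - edge_chain (e, true) : {ffun E -> int}) e)%:~R - 1 :> R.
      by rewrite !ffunE eqxx rmorphB /=; ring.
    apply: germ_ext (germ_Theta_left (c := c - edge_chain (e, true)) _
      (ell_gt0 e) (lexx _)) => [h|y].
      congr Theta; apply/funext => w.
      rewrite pairingD pairingN [(_ + _) w]/GRing.add /= [(- _) w]/GRing.opp /=.
      rewrite pairing_edge_chain /edge_integral /dmu /sgn /= mul1r form_ell.
      by ring.
    by rewrite netD netN cb net_edge_chain /dest /orig /= tv; lia.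
  rewrite !big_split /= !rmorphD /= rmorphN /= !sumz.
  have : (net c v)%:~R = 1 - (p == v)%:R :> R.
    by rewrite cb /= eqxx rmorphB /= !mulrz_nat.
  rewrite /net rmorphB /= !rmorph_sum /= sumrN; lra.
rewrite (coeff_marked_inner (mid_range fL)) ?addr0; last first.
  exact: mid_leaf f_tight p_finite.
have /andP[x0 xl] := valP q; rewrite /= ?addr0 mulrz_nat.
rewrite !big_cons big_nil addr0; set e := (val q).1; set y := (val q).2.
have [le|le] := eqVneq (len e) +oo%E.
  rewrite /= !(rderiv0_germ (k := 0)) ?addr0 //; exists 1 => // h _;
    by rewrite mul0r addr0; congr Theta; apply/funext => w;
       rewrite /dmu /= leaf_form // !mulr0.
have yl : y < ell e by rewrite /ell (negPf le) -lte_fin len_fineK.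
rewrite (rderiv0_germ (k := (c e)%:~R + (mid f e <= y)%R%:R)); last first.
  apply: germ_ext (germ_Theta_right (c := c) cb (ltW x0) yl) => h.
  congr Theta; apply/funext => w; rewrite /dmu /sgn /= -/e -/y; ring.
rewrite (rderiv0_germ (k := - (c e)%:~R - 1 + (y <= mid f e)%R%:R)); last first.
  apply: germ_ext (germ_Theta_left (c := c) cb x0 (ltW yl)) => h.
  congr Theta; apply/funext => w; rewrite /dmu /sgn /= -/e -/y; ring.
by rewrite /=; case: ltgtP => _ /=; ring.
Qed.

End ThetaDivisor.

(** * The distance orientation is not effective *)

Section Chord.
Variable R : realType.
Implicit Types (g : R -> R).

Lemma piecewise_sub (l l' : \bar R) g : (l' <= l)%E -> piecewise l g -> piecewise l' g.
Proof.
by move=> ll [bs h]; exists bs => x y x0 xy yl; apply: h => //; apply: le_trans ll.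
Qed.

Lemma piecewise_rev (l : R) g :
  piecewise l%:E g -> piecewise l%:E (fun y => g (l - y)).
Proof.
move=> [bs h]; exists (map (fun b => l - b) bs) => x y x0 xy; rewrite lee_fin => yl hb.
have [||||n hn] := h (l - y) (l - x).
- by rewrite subr_ge0.
- by rewrite lerD2l lerN2.
- by rewrite lee_fin gerBl.
- move=> b hbb; have := hb _ (map_f (fun b => l - b) hbb).
  by apply: contra => /andP[h1 h2]; apply/andP; split; lra.
exists (- n) => z /andP[xz zy].
rewrite (hn (l - z)) ?(hn (l - x)); first by rewrite rmorphN /=; ring.
  by apply/andP; split; lra.
by apply/andP; split; lra.
Qed.

(** Local convexity of a piecewise linear function: the slopes out of [x] to the two
    sides have a nonnegative sum. *)
Definition convex_at g (x : R) : Prop := forall a b,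
  germ (fun h => g (x + h)) a -> germ (fun h => g (x - h)) b -> 0 <= a + b.

(** A convex function lies above its tangent at [x].  Between breaks the function is
    linear, and at a break the slope can only grow; so induction on the number of
    breaks after [x] applies, from the next break on. *)
Lemma chord_ge g (l x s : R) : piecewise l%:E g ->
  (forall y, 0 < y < l -> convex_at g y) -> 0 <= x < l ->
  germ (fun h => g (x + h)) s -> g x + s * (l - x) <= g l.
Proof.
move=> gP cvx; have [bs hbs] := gP.
have [n] := ubnP (size [seq b <- bs | x < b < l]).
elim: n x s => // n IH x s hn /andP[x0 xl] gs.
have [y [/andP[xy yl] hy hor]] := next_break bs xl.
have [n' hn'] : exists n : int, forall z, x <= z <= y -> g z = g x + n%:~R * (z - x).
  by apply: hbs => //; exact: ltW.
have sE : s = n'%:~R.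
  apply: germ_unique gs _; exists (y - x); first by rewrite subr_gt0.
  move=> h /andP[h0 hy']; rewrite addr0 hn'; last by apply/andP; split; lra.
  by rewrite [x + h]addrC addrK.
have gy : g y = g x + s * (y - x) by rewrite sE; apply: hn'; rewrite lexx ltW.
move: yl; rewrite le_eqVlt => /predU1P[<-|yl]; first by rewrite gy.
have y0 : 0 < y by exact: le_lt_trans xy.
have [s' hs'] := piecewise_right gP (ltW y0) yl.
have left : germ (fun h => g (y - h)) (- s).
  exists (y - x); first by rewrite subr_gt0.
  move=> h /andP[h0 hy']; rewrite subr0 gy sE hn'; last by apply/andP; split; lra.
  by ring.
have ss' : 0 <= s'%:~R - s by apply: (cvx y) => //; rewrite y0.
have : g y + s'%:~R * (l - y) <= g l.
  apply: IH => //; last by rewrite (ltW y0).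
  rewrite -ltnS; apply: leq_trans hn; rewrite ltnS.
  have yb : y \in bs by case: hor => // h; rewrite h ltxx in yl.
  rewrite -[X in (_ < X)%N](count_predC (fun b => y < b < l)) count_filter.
  rewrite size_filter (eq_count (a2 := predI (fun b => y < b < l) (fun b => x < b < l)))
      => [|b]; last first.
    apply/idP/andP => [hb|[]//]; split=> //.
    by case/andP: hb => /(lt_trans xy) -> ->.
  rewrite -addn1 leq_add2l -has_count; apply/hasP; exists y => /=.
    by rewrite mem_filter xy yl yb.
  by rewrite ltxx.
by rewrite gy; nra.
Qed.

End Chord.

Section Noneffective.
Variables (R : realType) (C : tropical_curve R).
Notation V := (vertex C).
Notation E := (edge C).
Variables (p : V) (f : V -> R).
Hypothesis fL : one_lipschitz (pred1 p) f.
Hypothesis f_tight :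
  forall v, v != p -> exists2 d, dest d = v & f v = f (orig d) + ell d.1.
Hypothesis p_finite : forall e, len e = +oo%E -> tgt e != p.

Let m := mid f.
Let K := marked_divisor m.

Variables (D : divisor C) (h : curve_point C -> R).
Hypothesis D_ge0 : effective D.
Hypothesis hPL : PL h.
Hypothesis hdiv : is_div h (D - K).

(** The divisor of [h] is at least [- K], which is negative inside an edge only at its
    mark, where it is -1.  Bending [h] upwards by one unit of slope there makes it
    convex on the whole edge. *)
Let g (e : E) (y : R) : R := edge_fun h e y + (y - Num.min y (m e)).

Let pw_bend (l : \bar R) (b : R) : piecewise l (fun y => y - Num.min y b).
Proof.
apply: piecewiseD; last exact/piecewiseN/piecewise_min.
apply: (piecewise_ext (g := fun y => 0 + 1%:~R * y)); last exact: piecewise_affine.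
by move=> y _ _; rewrite add0r mul1r.
Qed.

Let germ_bend_right (x b : R) :
  germ (fun h => x + h - Num.min (x + h) b) (1 - (x < b)%R%:R).
Proof.
apply: germD; last exact/germN/germ_min_right.
by apply: germ_ext (germ_affine x 1) => y; rewrite mul1r.
Qed.

Let germ_bend_left (x b : R) :
  germ (fun h => x - h - Num.min (x - h) b) (- 1 + (x <= b)%R%:R).
Proof.
rewrite -[(x <= b)%R%:R]opprK; apply: germD; last exact/germN/germ_min_left.
by apply: germ_ext (germ_affine x (-1)) => y; rewrite mulN1r.
Qed.

Lemma interior_convex e (y : R) : 0 < y -> (y%:E < len e)%E ->
  forall a b, germ (fun x => edge_fun h e (y + x)) a ->
  germ (fun x => edge_fun h e (y - x)) b ->
  - ((len e != +oo%E) && (m e == y))%:R <= a + b.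
Proof.
move=> y0 yl a b ha hb; have [q qE _] := chart_inr y0 yl.
have := hdiv (inr q); rewrite /tangents !big_cons big_nil addr0.
rewrite (slopeE (k := a)); last first.
  by rewrite /= qE; apply: germ_ext ha => x /=; rewrite mul1r.
rewrite (slopeE (k := b)); last first.
  by rewrite /= qE; apply: germ_ext hb => x /=; rewrite mulN1r.
move=> <-; rewrite coeffB (coeff_marked_inner (mid_range fL)); last first.
  exact: mid_leaf f_tight p_finite.
by rewrite qE /= rmorphB /= mulrz_nat -[X in X <= _]add0r lerD2r ler0z.
Qed.

Lemma bent_convex e (y : R) : 0 < y -> (y%:E < len e)%E -> convex_at (g e) y.
Proof.
move=> y0 yl a b ha hb.
have [a' ha'] := piecewise_right (hPL e) (ltW y0) yl.
have [b' hb'] := piecewise_left (hPL e) y0 (ltW yl).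
have -> := germ_unique ha (germD ha' (germ_bend_right y (m e))).
have -> := germ_unique hb (germD hb' (germ_bend_left y (m e))).
have := interior_convex y0 yl ha' hb'.
case: (len e != _) => /=; case: ltgtP => _ /=; lra.
Qed.

Definition finite_vertex (v : V) := [forall e, (tgt e == v) ==> (len e != +oo%E)].

Lemma finite_vertexP v :
  reflect (forall e, tgt e = v -> len e != +oo%E) (finite_vertex v).
Proof.
apply: (iffP forallP) => [hv e te|hv e]; first by have := hv e; rewrite te eqxx.
by apply/implyP => /eqP; exact: hv.
Qed.

Lemma src_finite e : finite_vertex (src e).
Proof.
apply/finite_vertexP => e' te'; apply/eqP => le.
by have [_] := leaf_unique e le; rewrite te' eqxx.
Qed.

Lemma tgt_finite e : len e != +oo%E -> finite_vertex (tgt e).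
Proof.
move=> le; apply/finite_vertexP => e' te'; apply/eqP => le'.
have [/(_ (esym te')) ee' _] := leaf_unique e le'.
by move: le; rewrite ee' le'.
Qed.

Lemma int_le_of_lt (n a : int) : (n%:~R < a%:~R + 1 :> R) -> n <= a.
Proof.
by rewrite -[1]/(1%:~R) -rmorphD ltr_int ltzD1.
Qed.

(** The values of [h] at the infinite vertices are meaningless and only the finite
    ones are compared.  Among those where [h] is maximal, [v] is closest to [p]. *)
Section AtMaximum.
Variable v : V.
Hypothesis v_max : forall u, finite_vertex u -> h (inl u) <= h (inl v).
Hypothesis v_closest :
  forall u, finite_vertex u -> f u < f v -> h (inl u) < h (inl v).

(** The tangent inequality for the bent function bounds the slope [n] by the values of
    [h] at the two ends of [e].  If the mark is not at [v] this gives [n < 1]; if it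
    is, the other end is closer to [p], so [h] is smaller there and [n < 0].  Along a
    leaf [h] cannot grow: it is convex, and not increasing near infinity. *)
Lemma slope_src e : src e = v ->
  exists2 n : int, has_slope h (inl v) (e, true) n%:~R & n <= - (m e == 0)%:R.
Proof.
move=> sv.
have [n hn] : exists n : int, has_slope h (inl v) (e, true) n%:~R.
  by apply: PL_slope hPL _; rewrite /= mem_cat map_f // mem_filter sv eqxx mem_enum.
exists n => //; apply: int_le_of_lt.
have hn0 : germ (fun x => edge_fun h e (0 + x)) n%:~R.
  by apply: germ_ext hn => x; rewrite add0r.
have h0 : edge_fun h e 0 = h (inl v) by rewrite /edge_fun chart_le0 // sv.
have [le|le] := eqVneq (len e) +oo%E.
  have me : m e = ell e by exact: mid_leaf f_tight p_finite _ le.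
  rewrite me gt_eqF ?ell_gt0 // oppr0 add0r ltNge; apply/negP => n1.
  have [k [B hB] k0] : exists2 k : R, end_germ (edge_fun h e) k & 0 <= k.
    have [k hk] : exists k : int, has_slope h (inl (tgt e)) (e, false) k%:~R.
      apply: PL_slope hPL _; rewrite /= mem_cat; apply/orP; right.
      by rewrite map_f // mem_filter eqxx mem_enum.
    exists k%:~R; first by move: hk; rewrite /= le.
    have := hdiv (inl (tgt e)); rewrite sum_tangents big_pred0; last first.
      by move=> e'; have [_ /negPf] := leaf_unique e' le.
    rewrite (big_pred1 e) => [|e']; last first.
      by apply/eqP/eqP => [/(leaf_unique e' le).1|->].
    rewrite (slopeE hk) add0r => <-; rewrite ler0z coeffB subr_ge0.
    apply: le_trans (D_ge0 _); rewrite coeff_marked_vertex; last exact: mid_range fL.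
    rewrite big_pred0; last by move=> e'; have [_ /negPf] := leaf_unique e' le.
    rewrite (big_pred1 e) => [|e']; last first.
      by apply/eqP/eqP => [/(leaf_unique e' le).1|->].
    by rewrite me eqxx.
  (* At this distance a function of slope at least 1 starting from the value of [h]
     at [v] would exceed the value at [B], which bounds [h] further on. *)
  pose L := Num.max B 0 + `|edge_fun h e B| + `|edge_fun h e 0| + 1.
  have LB : B <= L /\ 0 < L.
    have := normr_ge0 (edge_fun h e B); have := normr_ge0 (edge_fun h e 0).
    rewrite /L; have : B <= Num.max B 0 /\ 0 <= Num.max B 0.
      by rewrite !le_max !lexx orbT.
    by move=> [? ?] ? ?; split; lra.
  have : edge_fun h e 0 + n%:~R * (L - 0) <= edge_fun h e L.
    apply: chord_ge => //; last by rewrite lexx LB.2.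
      by apply: piecewise_sub (hPL e); rewrite le leey.
    move=> y /andP[y0 yL] a b ha hb.
    have := interior_convex y0 _ ha hb; rewrite le eqxx /= oppr0; apply.
    exact: ltry.
  rewrite subr0 (hB L LB.1).
  have := ler_norm (edge_fun h e B); have := ler_norm (- edge_fun h e 0).
  rewrite normrN => i1 i2 i3.
  have i4 : L <= n%:~R * L by rewrite ler_peMl // ltW // LB.2.
  have i5 : 0 <= k * (L - B) by rewrite mulr_ge0 // subr_ge0 LB.1.
  have i6 : 0 <= Num.max B 0 by rewrite le_max lexx orbT.
  by move: i1 i2 i3 i4 i5 i6; rewrite /L; lra.
have lE : len e = (ell e)%:E by rewrite /ell (negPf le) len_fineK.
have : g e 0 + (n%:~R + (1 - (0 < m e)%R%:R)) * (ell e - 0) <= g e (ell e).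
  apply: chord_ge.
  - by rewrite -lE; apply: piecewiseD; [exact: hPL|exact: pw_bend].
  - by move=> y /andP[y0 yl]; apply: bent_convex => //; rewrite lE lte_fin.
  - by rewrite lexx ell_gt0.
  - exact: germD hn0 (germ_bend_right 0 (m e)).
rewrite subr0.
have /andP[m0 ml] := mid_range fL e; rewrite -/(m e) in m0 ml.
rewrite /g h0 min_l // subr0 min_r // /edge_fun chart_tgt ?ell_gt0 ?lE //.
move: m0; rewrite le_eqVlt eq_sym => /orP[/eqP m0|m0].
  rewrite m0 eqxx ltxx => hc; rewrite /= rmorphN /=.
  have : h (inl (tgt e)) < h (inl v).
    apply: v_closest; first exact: tgt_finite.
    by move: m0; rewrite /m /mid -sv; have := ell_gt0 e; lra.
  move: hc; rewrite mulr0n subr0 addr0 mulrDl mul1r subr0 rmorph1 addNr => hc hlt.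
  rewrite ltNge; apply/negP => n0.
  have := mulr_ge0 n0 (ltW (ell_gt0 e)); lra.
rewrite (gt_eqF m0) m0 mulr0n oppr0 add0r mulr1n subrr !addr0 => hc.
have hle := v_max (tgt_finite le).
rewrite ltNge; apply/negP => n1.
have : ell e <= n%:~R * ell e by rewrite ler_peMl // ltW // ell_gt0.
lra.
Qed.

(** The mirror image of [slope_src], along the reversed edge. *)
Lemma slope_tgt e : tgt e = v -> len e != +oo%E ->
  exists2 n : int, has_slope h (inl v) (e, false) n%:~R & n <= - (m e == ell e)%:R.
Proof.
move=> tv le.
have [n hn] : exists n : int, has_slope h (inl v) (e, false) n%:~R.
  apply: PL_slope hPL _; rewrite /= mem_cat; apply/orP; right.
  by rewrite map_f // mem_filter tv eqxx mem_enum.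
exists n => //; apply: int_le_of_lt.
have lE : len e = (ell e)%:E by rewrite /ell (negPf le) len_fineK.
have l0 := ell_gt0 e.
have hn0 : germ (fun x => edge_fun h e (ell e - (0 + x))) n%:~R.
  by move: hn; rewrite /= (negPf le) lE /=; apply: germ_ext => x; rewrite add0r.
pose b := ell e - m e.
pose g' (y : R) : R := edge_fun h e (ell e - y) + (y - Num.min y b).
have : g' 0 + (n%:~R + (1 - (0 < b)%R%:R)) * (ell e - 0) <= g' (ell e).
  apply: chord_ge.
  - apply: piecewiseD (pw_bend _ _); apply: piecewise_rev.
    by rewrite -lE; exact: hPL.
  - move=> y /andP[y0 yl] a a' ha ha'.
    have yl' : (((ell e - y)%R)%:E < len e)%E by rewrite lE lte_fin gtrBl.
    have y0' : 0 < ell e - y by rewrite subr_gt0.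
    have [c hc] := piecewise_right (hPL e) (ltW y0') yl'.
    have [c' hc'] := piecewise_left (hPL e) y0' (ltW yl').
    have := interior_convex y0' yl' hc hc'; rewrite le /=.
    have hcr : germ (fun x => edge_fun h e (ell e - (y - x))) c%:~R.
      by apply: germ_ext hc => x; congr (edge_fun h e _); ring.
    have hcl : germ (fun x => edge_fun h e (ell e - (y + x))) c'%:~R.
      by apply: germ_ext hc' => x; congr (edge_fun h e _); ring.
    have -> := germ_unique ha (germD hcl (germ_bend_right y b)).
    have -> := germ_unique ha' (germD hcr (germ_bend_left y b)).
    have -> : (m e == ell e - y) = (y == b) by apply/eqP/eqP; rewrite /b; lra.
    by case: ltgtP => _ /=; lra.
  - by rewrite lexx.
  - exact: germD hn0 (germ_bend_right 0 b).
rewrite subr0.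
have /andP[m0 ml] := mid_range fL e; rewrite -/(m e) in m0 ml.
have b0 : 0 <= b by rewrite subr_ge0.
have bl : b <= ell e by rewrite gerBl.
rewrite /g' subrr !subr0 (min_l b0) (min_r bl) subr0 addr0.
rewrite /edge_fun (chart_le0 e (lexx 0)) chart_tgt ?lE // tv.
have -> : (m e == ell e) = (b == 0) by rewrite subr_eq0 eq_sym.
move: b0; rewrite le_eqVlt eq_sym => /orP[/eqP b0|b0].
  rewrite b0 eqxx ltxx mulr0n !subr0 mulrDl mul1r rmorphN rmorph1 addNr => hc.
  have hlt : h (inl (src e)) < h (inl v).
    apply: v_closest; first exact: src_finite.
    by move: b0; rewrite /b /m /mid -tv; lra.
  rewrite ltNge; apply/negP => n0.
  have := mulr_ge0 n0 (ltW l0); lra.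
rewrite (gt_eqF b0) b0 mulr0n oppr0 add0r mulr1n subrr addr0 => hc.
have hle := v_max (src_finite e).
rewrite ltNge; apply/negP => n1.
have : ell e <= n%:~R * ell e by rewrite ler_peMl // ltW.
lra.
Qed.

End AtMaximum.

(** At a closest maximum [v] the slopes of [h] add up to at most minus the number of
    marks at [v], whereas the coefficient of [D - K] is at least 1 minus that number. *)
Lemma no_effective_function : False.
Proof.
have pfin : finite_vertex p.
  by apply/finite_vertexP => e te; apply/negP => /eqP /p_finite; rewrite te eqxx.
pose v1 := [arg max_(v > p | finite_vertex v) h (inl v)]%O.
have [v1fin v1max] : finite_vertex v1 /\
    forall u, finite_vertex u -> h (inl u) <= h (inl v1).
  by rewrite /v1; case: arg_maxP => // v.
pose Q v := finite_vertex v && (h (inl v) == h (inl v1)).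
have Qv1 : Q v1 by rewrite /Q v1fin eqxx.
pose v := [arg min_(v < v1 | Q v) f v]%O.
have [Qv vmin] : Q v /\ forall u, Q u -> f v <= f u.
  by rewrite /v; case: arg_minP => // v.
have /andP[vfin /eqP hv] := Qv.
have v_max u : finite_vertex u -> h (inl u) <= h (inl v) by rewrite hv; exact: v1max.
have v_closest u : finite_vertex u -> f u < f v -> h (inl u) < h (inl v).
  move=> fu fuv; rewrite lt_neqAle v_max // andbT; apply/negP => /eqP hu.
  have : Q u by rewrite /Q fu hu hv eqxx.
  by move=> /vmin; rewrite leNgt fuv.
have : (coeff (inl v) (D - K))%:~R <=
    \sum_(e | src e == v) - (m e == 0)%:R +
    \sum_(e | tgt e == v) - (m e == ell e)%:R :> R.
  rewrite (hdiv (inl v)) sum_tangents lerD // ler_sum // => e /eqP ev.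
    have [n hn nm] := slope_src v_max v_closest ev.
    by move: nm; rewrite (slopeE hn) -(ler_int R) rmorphN /= mulrz_nat.
  have [n hn nm] := slope_tgt v_max v_closest ev (finite_vertexP _ vfin _ ev).
  by move: nm; rewrite (slopeE hn) -(ler_int R) rmorphN /= mulrz_nat.
have sumz (P : pred E) (b : E -> bool) :
    (\sum_(e | P e) (b e)%:R)%:~R = \sum_(e | P e) (b e)%:R :> R.
  by rewrite rmorph_sum; apply: eq_bigr => e _; rewrite /= mulrz_nat.
rewrite coeffB coeff_marked_vertex; last exact: mid_range fL.
rewrite !sumrN rmorphB rmorphB rmorphD /= !sumz.
have : 0 <= (coeff (inl v) D)%:~R :> R by rewrite ler0z.
lra.
Qed.

End Noneffective.

(** * Orientations along a cycle, and the main theorem *)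

Section MuAdditive.
Variables (R : realType) (C : tropical_curve R).
Implicit Types (p : curve_point C).

Lemma mu_is_zmod_morphism p0 p : zmod_morphism (mu p0 p).
Proof.
have [c _ cE] := mu_chain p0 p.
have formB (w w' : oneform C) e : ((w - w') e)%:~R = (w e)%:~R - (w' e)%:~R :> R.
  by rewrite -rmorphB /= !ffunE.
have aB q (w w' : oneform C) :
    anchor_integral q (w - w') = anchor_integral q w - anchor_integral q w'.
  by case: q => [v|q] /=; rewrite ?subr0 // formB mulrBl.
move=> w w'; rewrite !cE !aB.
have -> : pairing c (w - w') = pairing c w - pairing c w'.
  by rewrite /pairing -sumrB; apply: eq_bigr => e _; rewrite formB; ring.
by ring.
Qed.

HB.instance Definition _ p0 p :=
  GRing.isZmodMorphism.Build (oneform C) R (mu p0 p) (mu_is_zmod_morphism p0 p).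

End MuAdditive.

Section ThetaCharacteristics.
Variables (R : realType) (C : tropical_curve R).
Notation V := (vertex C).
Notation E := (edge C).

Lemma exists_finite_vertex : exists p : V, forall e, len e = +oo%E -> tgt e != p.
Proof.
have [e0 _|no_edge] := pickP (fun _ : E => true).
  by exists (src e0) => e le; rewrite eq_sym; have [_] := leaf_unique e0 le.
have /card_gt0P[v _] := vertex_nonempty C.
by exists v => e; have := no_edge e.
Qed.

Section CycleOrientation.
Variable g : {ffun E -> int}.
Hypothesis g_bal : balanced g.
Hypothesis g_le1 : forall e, `|g e| <= 1.

Definition on_cycle (v : V) : bool :=
  [exists e, (g e != 0) && ((src e == v) || (tgt e == v))].

Lemma on_cycle_src e : g e != 0 -> on_cycle (src e).
Proof. by move=> ge; apply/existsP; exists e; rewrite ge eqxx. Qed.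

Lemma on_cycle_tgt e : g e != 0 -> on_cycle (tgt e).
Proof. by move=> ge; apply/existsP; exists e; rewrite ge eqxx orbT. Qed.

Lemma leaf_off_cycle e : len e = +oo%E -> ~~ on_cycle (tgt e).
Proof.
move=> le; apply/negP => /existsP[e' /andP[ge']].
have [h1 /negPf ->] := leaf_unique e' le.
move=> /eqP /h1 ee'; move: ge'; rewrite ee'.
by have := leaf_form (Form g_bal) le => /= ->.
Qed.

(** Otherwise [g] would only leave [v], against its balance. *)
Lemma cycle_enters v : on_cycle v ->
  exists e, (g e = 1 /\ tgt e = v) \/ (g e = -1 /\ src e = v).
Proof.
move=> /existsP[e0 /andP[ge0 e0v]]; apply: contrapT => hn.
have int3 (a : int) : `|a| <= 1 -> [\/ a = 0, a = 1 | a = -1].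
  case: a => [[|[|n]]|[|n]] // _; by [constructor 1|constructor 2|constructor 3].
have tle e : tgt e == v -> g e <= 0.
  move=> /eqP te; case: (int3 _ (g_le1 e)) => [->|h|->] //.
  by case: hn; exists e; left.
have sge e : src e == v -> 0 <= g e.
  move=> /eqP se; case: (int3 _ (g_le1 e)) => [->|->|h] //.
  by case: hn; exists e; right.
have : \sum_(e | src e == v) g e + \sum_(e | tgt e == v) - g e = 0.
  rewrite sumrN; apply/eqP; rewrite subr_eq0.
  by move/forallP: g_bal => /(_ v).
have sum1 : 0 <= \sum_(e | src e == v) g e by apply: sumr_ge0.
have sum2 : 0 <= \sum_(e | tgt e == v) - g e.
  by apply: sumr_ge0 => e /tle; rewrite oppr_ge0.
move/eqP; rewrite paddr_eq0 // => /andP[/eqP h1 /eqP h2].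
case/orP: e0v => e0v.
  by move/eqP: (psumr_eq0P sge h1 e0v); apply/negP.
have : forall e, tgt e == v -> 0 <= - g e by move=> e /tle; rewrite oppr_ge0.
move=> h; have /eqP := psumr_eq0P h h2 e0v; rewrite oppr_eq0.
by apply/negP.
Qed.

Variable f : V -> R.
Hypothesis fL : one_lipschitz on_cycle f.
Hypothesis f_tight : forall v, ~~ on_cycle v ->
  exists2 d, dest d = v & f v = f (orig d) + ell d.1.

(** Where [g] vanishes this is the orientation by the distance to the cycle.  On the
    cycle [f] is 0 and the mark is the end of [e] to which [g] points. *)
Definition cycle_mark (e : E) : R := mid f e + (g e)%:~R * ell e / 2.

Lemma cycle_markE e : g e != 0 -> cycle_mark e = (1 + (g e)%:~R) / 2 * ell e.
Proof.
move=> ge; rewrite /cycle_mark /mid (fL.1 _ (on_cycle_src ge)).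
by rewrite (fL.1 _ (on_cycle_tgt ge)); field.
Qed.

Lemma cycle_mark_range e : 0 <= cycle_mark e <= ell e.
Proof.
have l0 := ell_gt0 e.
have [ge|ge] := eqVneq (g e) 0.
  by rewrite /cycle_mark ge !mul0r addr0; exact: mid_range fL e.
rewrite cycle_markE //.
have : `|(g e)%:~R : R| <= 1 by rewrite -intr_norm -[1]/(1%:~R) ler_int.
by rewrite ler_norml => /andP[h1 h2]; apply/andP; split; nra.
Qed.

Lemma cycle_mark_leaf e : len e = +oo%E -> cycle_mark e = ell e.
Proof.
move=> le; have := leaf_form (Form g_bal) le => /= ge.
rewrite /cycle_mark ge !mul0r addr0.
exact: mid_leaf f_tight leaf_off_cycle _ le.
Qed.

(** A vertex on the cycle is the mark of the edge by which [g] enters it; any other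
    vertex is the mark of the tight edge into it. *)
Lemma cycle_divisor_effective : effective (marked_divisor cycle_mark).
Proof.
move=> [v|q]; last first.
  by rewrite (coeff_marked_inner cycle_mark_range) ?ler0n //; exact: cycle_mark_leaf.
rewrite (coeff_marked_vertex cycle_mark_range).
have [e [[te me]|[se me]]] : exists e, (tgt e = v /\ cycle_mark e = ell e) \/
    (src e = v /\ cycle_mark e = 0).
- have [/cycle_enters[e he]|hv] := boolP (on_cycle v).
    exists e; case: he => [[ge ev]|[ge ev]]; [left|right]; split=> //.
      by rewrite cycle_markE ge // rmorph1; field.
    by rewrite cycle_markE ge // rmorphN rmorph1 subrr !mul0r.
  have off e : (src e == v) || (tgt e == v) -> g e = 0.
    move=> ev; apply: contraNeq hv => ge; apply/existsP; exists e.
    by rewrite ge.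
  have [[e []]] := f_tight hv; rewrite /dest /orig /= => ev fv.
    exists e; left; split=> //.
    by rewrite /cycle_mark off ?ev ?eqxx ?orbT // /mid ev fv; field.
  exists e; right; split=> //.
  by rewrite /cycle_mark off ?ev ?eqxx // /mid ev fv; field.
- rewrite (bigD1 e (P := fun e => tgt e == v)) ?te //= me eqxx.
  rewrite subr_ge0 mulr1n addrCA lerDl.
  by apply: addr_ge0; apply: sumr_ge0 => i _; rewrite ler0n.
- rewrite (bigD1 e (P := fun e => src e == v)) ?se //= me eqxx.
  rewrite subr_ge0 mulr1n -addrA lerDl.
  by apply: addr_ge0; apply: sumr_ge0 => i _; rewrite ler0n.
Qed.

(** Modulo the lattice the image of a marked divisor is a constant plus the sum of
    [m e * w e].  The marks differ by half of [g e * ell e] and half the gradient of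
    [f - f0], which is orthogonal to the form [w]. *)
Lemma abel_jacobi_cycle_divisor p0 (f0 : V -> R) :
  (forall e, 0 <= mid f0 e <= ell e) ->
  exists2 l, lattice l &
    abel_jacobi p0 (marked_divisor cycle_mark) =
    abel_jacobi p0 (marked_divisor (mid f0)) + 2^-1 \*o pairing g + l.
Proof.
move=> hf0.
have l1 := abel_jacobi_marked p0 cycle_mark_range.
have l2 := abel_jacobi_marked p0 hf0.
eexists; first exact: latticeD l1 (latticeN l2).
apply/funext => w.
have fB (a b : oneform C -> R) : (a - b) w = a w - b w by [].
have fD (a b : oneform C -> R) : (a + b) w = a w + b w by [].
have fN (a : oneform C -> R) : (- a) w = - a w by [].
rewrite !(fB, fD, fN) /= !fct_sumE.
under [X in _ = _ + (_ - (X - _) - _)]eq_bigr do rewrite fD.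
under [X in _ = _ + (_ - (_ - (X - _)))]eq_bigr do rewrite fD.
rewrite !big_split /= /form_at.
have : \sum_e cycle_mark e * (w e)%:~R =
    2^-1 * pairing g w + \sum_e mid f0 e * (w e)%:~R.
  have z1 := sum_coboundary0 f (valP w).
  have z2 := sum_coboundary0 f0 (valP w).
  set Z1 := \sum_e _ in z1; set Z2 := \sum_e _ in z2.
  transitivity (2^-1 * pairing g w + \sum_e mid f0 e * (w e)%:~R +
      2^-1 * Z1 - 2^-1 * Z2); last by rewrite z1 z2 mulr0 addr0 subr0.
  rewrite /Z1 /Z2 /pairing !mulr_sumr -!big_split -sumrB /=.
  by apply: eq_bigr => e _; rewrite /cycle_mark /mid; field.
lra.
Qed.

End CycleOrientation.
End ThetaCharacteristics.

Theorem lemma4 (R : realType) (C : tropical_curve R) (p0 : curve_point C)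
    (kappa : {additive oneform C -> R})
    (hkappa : is_inversion_constant p0 kappa)
    (K0 : divisor C) (K0_deg : deg K0 = (genus C)%:Z - 1)
    (K0_kappa : eq_mod_lattice (abel_jacobi p0 K0) (- (kappa : oneform C -> R))) :
  half_period_translates p0 K0 `\` W ((genus C)%:Z - 1) = [set dclass K0].
Proof.
have [p p_finite] := exists_finite_vertex C.
have [f fL f_tight] := distance_potential (S := pred1 p) (eqxx p).
pose K := marked_divisor (mid f).
(* For [lambda = mu p] the inversion formula reads [mu K + mu p + kappa = mu p]. *)
have hK := hkappa _ _ (theta_divisor_distance fL f_tight p_finite p0).
have [l0 l0L l0E] : exists2 l, lattice l & abel_jacobi p0 K0 = abel_jacobi p0 K + l.
  exists (abel_jacobi p0 K0 - abel_jacobi p0 K); last by rewrite addrC subrK.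
  have := latticeD K0_kappa (latticeN hK).
  rewrite abel_jacobiD.
  have -> : abel_jacobi p0 (<< inl p >> : divisor C) = mu p0 (inl p).
    by apply/funext => w; rewrite abel_jacobiE dsumU.
  by rewrite opprK [X in - X]addrAC addrK opprD addrACA subrr addr0.
have K0K : lin_equiv K0 K.
  apply: (@abel _ _ p0); first by rewrite degB deg_marked K0_deg subrr.
  by rewrite abel_jacobiD abel_jacobiN l0E addrAC subrr add0r.
have lin_refl (D : divisor C) : lin_equiv D D.
  apply: (@abel _ _ p0); first by rewrite degB subrr.
  by rewrite abel_jacobiD abel_jacobiN subrr; exact: lattice0.
apply/seteqP; split=> [X [[T [degT [c2 _ cE]] <-] notW]|_ ->]; last first.
  split.
    exists 0; last by rewrite addr0.
    split; first by rewrite deg0.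
    have -> : abel_jacobi p0 (0 : divisor C) = 0.
      by apply/funext => w; rewrite abel_jacobiE dsum0.
    by rewrite /half_lattice addr0; exact: lattice0.
  move=> [D [degD Deff] DK0].
  have DK : lin_equiv D K.
    apply: lin_equiv_trans K0K.
    suff : dclass D D by rewrite DK0.
    exact: lin_refl.
  have [h hPL hdiv] := DK.
  exact: (no_effective_function fL f_tight p_finite Deff hPL hdiv).
have [c cb cE'] : exists2 c, balanced c &
    abel_jacobi p0 T + abel_jacobi p0 T = pairing c.
  by apply/latticeP; exists c2.
have [g [c' [gb c'b cgc g1]]] := mod2_representative cb.
have TE : abel_jacobi p0 T = 2^-1 \*o pairing g + pairing c'.
  apply/funext => w.
  have h : abel_jacobi p0 T w + abel_jacobi p0 T w =
      pairing g w + (pairing c' w + pairing c' w).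
    by have := congr1 (fun F => F w) cE'; rewrite cgc !pairingD.
  change (abel_jacobi p0 T w = 2^-1 * pairing g w + pairing c' w); lra.
(* If [g = 0] then the image of [T] is the lattice vector [c'] and [T] is principal;
   otherwise the class of [K0 + T] contains an effective divisor. *)
have [g0|/existsP[e ge]] : g = 0 \/ [exists e, g e != 0].
  case: (boolP [exists e, g e != 0]) => [|h]; [by right|left].
  apply/ffunP => e; rewrite ffunE; apply/eqP; apply: contraNT h => ge.
  by apply/existsP; exists e.
- apply: lin_equiv_dclass; rewrite /lin_equiv addrAC subrr add0r.
  apply: (@abel _ _ p0) => //; apply/latticeP; exists c' => //.
  rewrite TE g0 pairing0; apply/funext => w.
  by rewrite [LHS]/GRing.add /= mulr0 add0r.
case: notW.
have [f' f'L f'_tight] := distance_potential (on_cycle_src ge).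
exists (marked_divisor (cycle_mark g f')).
  split; first exact: deg_marked.
  exact: cycle_divisor_effective.
apply: lin_equiv_dclass; apply: lin_equiv_sym.
apply: (@abel _ _ p0).
  by rewrite degB degD deg_marked K0_deg degT addr0 subrr.
have [l lL KgE] := abel_jacobi_cycle_divisor g1 f'L p0 (mid_range fL).
have c'L : lattice (pairing c') by apply/latticeP; exists c'.
rewrite abel_jacobiD abel_jacobiN abel_jacobiD l0E TE KgE.
set a := _ \*o _; rewrite -/K; set b := abel_jacobi p0 K.
have -> : b + l0 + (a + pairing c') - (b + a + l) = l0 + pairing c' - l.
  apply/funext => w.
  change (b w + l0 w + (a w + pairing c' w) - (b w + a w + l w) =
    l0 w + pairing c' w - l w); ring.
by apply: latticeD (latticeN lL); exact: latticeD.
Qed.
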